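(* Let $R$ be a commutative Gorenstein ring and let $G$ be a group such that $RG$ is a left noetherian ring. Then $\mathrm{sfli}RG<\infty$ if and only if $\mathrm{silf}RG<\infty$. In this case, one has $\mathrm{sfli}RG=\mathrm{silf}RG$.
   Context: A commutative Gorenstein ring here is a commutative noetherian ring of finite self-injective dimension. $RG$ is the group ring. For a ring $\Lambda$: $\mathrm{silf}\Lambda$ is the supremum of the injective dimensions of flat left $\Lambda$-modules; $\mathrm{sfli}\Lambda$ is the supremum of the flat dimensions of injective left $\Lambda$-modules. *)

(* Defs.v *)
From HB Require Import structures.
From mathcomp Require Import all_boot all_order all_algebra.
From mathcomp Require Import finmap boolp constructive_ereal.
(* The notations of monalg clash with those loaded by constructive_ereal. *)
From mathcomp.multinomials Require Import -(notations) monalg.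

Set Implicit Arguments.
Unset Strict Implicit.
Unset Printing Implicit Defensive.

Import Order.TTheory GRing.Theory Num.Theory.

Local Open Scope ring_scope.
Local Open Scope quotient_scope.

(* The group ring RG: finitely supported functions G -> R under convolution.  *)
(* The ring instance of {malg R[K]} is restricted to monoids K in which only  *)
(* 1 is invertible, so the product is set up here for an arbitrary group.     *)

Definition group_ring (R : pzRingType) (G : groupType) : Type := malg G R.

Section GroupRing.
Variables (R : pzRingType) (G : groupType).

HB.instance Definition _ := GRing.Zmodule.on (group_ring R G).

Implicit Types (u v w : group_ring R G) (x y : G).

Local Notation term u x v y := (mkmalgU (x * y)%g (mcoeff x u * mcoeff y v)).

Definition grone : group_ring R G := mkmalgU (1%g : G) (1 : R).

Definition grmul u v : group_ring R G :=
  \sum_(x <- msupp u) \sum_(y <- msupp v) term u x v y.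

Lemma grmulE (d e : {fset G}) u v :
  (msupp u `<=` d)%fset -> (msupp v `<=` e)%fset ->
  grmul u v = \sum_(x <- d) \sum_(y <- e) term u x v y.
Proof.
move=> ud ve; rewrite /grmul (big_fset_incl _ ud) /=.
  apply/eq_bigr => x _; apply/big_fset_incl => // y _ /mcoeff_outdom ->.
  by rewrite mulr0 monalgU0.
move=> x _ /mcoeff_outdom ux.
by rewrite big1 // => y _; rewrite ux mul0r monalgU0.
Qed.

Lemma grmulUU x y (a b : R) :
  grmul (mkmalgU x a) (mkmalgU y b) = mkmalgU (x * y)%g (a * b).
Proof.
rewrite (grmulE (@msuppU_le _ _ _ _) (@msuppU_le _ _ _ _)).
by rewrite !big_seq_fset1 !mcoeffUU.
Qed.

Lemma grmulDl : left_distributive grmul +%R.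
Proof.
move=> u v w.
rewrite [in RHS](grmulE (fsubsetUl _ (msupp v)) (fsubset_refl _)).
rewrite [in RHS](grmulE (fsubsetUr (msupp u) _) (fsubset_refl _)).
rewrite (grmulE (msuppD_le _ _) (fsubset_refl _)).
rewrite -big_split /=; apply/eq_bigr => x _.
rewrite -big_split /=; apply/eq_bigr => y _.
by rewrite mcoeffD mulrDl monalgUD.
Qed.

Lemma grmulDr : right_distributive grmul +%R.
Proof.
move=> w u v.
rewrite [in RHS](grmulE (fsubset_refl _) (fsubsetUl _ (msupp v))).
rewrite [in RHS](grmulE (fsubset_refl _) (fsubsetUr (msupp u) _)).
rewrite (grmulE (fsubset_refl _) (msuppD_le _ _)).
rewrite -big_split /=; apply/eq_bigr => x _.
rewrite -big_split /=; apply/eq_bigr => y _.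
by rewrite mcoeffD mulrDr monalgUD.
Qed.

Lemma grmul0l v : grmul 0 v = 0.
Proof. by rewrite /grmul msupp0 big_seq_fset0. Qed.

Lemma grmul0r u : grmul u 0 = 0.
Proof. by rewrite /grmul; apply: big1 => x _; rewrite msupp0 big_seq_fset0. Qed.

Lemma grmul_suml (I : Type) (r : seq I) (F : I -> group_ring R G) v :
  grmul (\sum_(i <- r) F i) v = \sum_(i <- r) grmul (F i) v.
Proof.
exact: (big_morph (grmul^~ v) (fun _ _ => grmulDl _ _ _) (grmul0l v)).
Qed.

Lemma grmul_sumr (I : Type) (r : seq I) (F : I -> group_ring R G) u :
  grmul u (\sum_(i <- r) F i) = \sum_(i <- r) grmul u (F i).
Proof.
exact: (big_morph (grmul u) (fun _ _ => grmulDr _ _ _) (grmul0r u)).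
Qed.

Lemma grmul1l : left_id grone grmul.
Proof.
move=> u; rewrite [in LHS](monalgE u) grmul_sumr [RHS]monalgE.
by apply/eq_bigr => x _; rewrite grmulUU mul1r mul1g.
Qed.

Lemma grmul1r : right_id grone grmul.
Proof.
move=> u; rewrite [in LHS](monalgE u) grmul_suml [RHS]monalgE.
by apply/eq_bigr => x _; rewrite grmulUU mulr1 mulg1.
Qed.

Lemma grmulA : associative grmul.
Proof.
move=> u v w; rewrite (monalgE u) (grmul_suml _ _ v) (grmul_suml _ _ w).
rewrite grmul_suml; apply/eq_bigr => x _.
rewrite (monalgE v) (grmul_suml _ _ w) (grmul_sumr _ _ (mkmalgU x _)).
rewrite (grmul_sumr _ _ (mkmalgU x _)) (grmul_suml _ _ w).
apply/eq_bigr => y _; rewrite (monalgE w) (grmul_sumr _ _ (mkmalgU y _)).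
rewrite grmulUU (grmul_sumr _ _ (mkmalgU x _)) grmul_sumr.
apply/eq_bigr => z _.
by rewrite !grmulUU mulrA mulgA.
Qed.

HB.instance Definition _ := GRing.Zmodule_isPzRing.Build (group_ring R G)
  grmulA grmul1l grmul1r grmulDl grmulDr.

End GroupRing.

Definition left_ideal (S : pzRingType) (I : S -> Prop) : Prop :=
  [/\ I 0, forall x y, I x -> I y -> I (x + y) & forall a x, I x -> I (a * x)].

Definition left_noetherian (S : pzRingType) : Prop :=
  forall I : S -> Prop, left_ideal I ->
  exists s : seq S,
    forall x, I x <-> exists c : nat -> S, x = \sum_(i < size s) c i * s`_i.

(* The tensor product of a right S-module A (a left module over the converse  *)
(* ring S^c) with a left S-module M: the free abelian group on A x M modulo   *)
(* the subgroup generated by the balanced biadditivity relations.             *)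

Section Tensor.
Variable S : pzRingType.

Section Construction.
Variables (A : lmodType S^c) (M : lmodType S).

Local Notation gen a m := (mkmalgU ((a, m) : (A * M)%type) (1 : int)).

Inductive tensor_relation : malg (A * M)%type int -> Prop :=
| TensorZero : tensor_relation 0
| TensorSub t u :
    tensor_relation t -> tensor_relation u -> tensor_relation (t - u)
| TensorDl a b m : tensor_relation (gen (a + b) m - gen a m - gen b m)
| TensorDr a m n : tensor_relation (gen a (m + n) - gen a m - gen a n)
| TensorBalanced (s : S) a m :
    tensor_relation (gen ((s : S^c) *: a) m - gen a (s *: m)).

Definition tensor_relb : {pred malg (A * M)%type int} :=
  fun t => `[< tensor_relation t >].

Fact tensor_relb_zmod_closed : zmod_closed tensor_relb.
Proof.
split; first by apply/asboolP; exact: TensorZero.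
by move=> t u /asboolP ht /asboolP hu; apply/asboolP; exact: TensorSub.
Qed.

HB.instance Definition _ := GRing.isZmodClosed.Build
  (malg (A * M)%type int) tensor_relb tensor_relb_zmod_closed.

Definition tensor : zmodType := Quotient.quot tensor_relb.

Definition tensor_pure (a : A) (m : M) : tensor :=
  \pi_(Quotient.quot tensor_relb) (gen a m).

End Construction.

Section Functoriality.
Variables (A B : lmodType S^c) (M : lmodType S) (f : {linear A -> B}).

Definition tensor_lift (t : malg (A * M)%type int) :
    malg (B * M)%type int :=
  \sum_(p <- msupp t) mkmalgU (f p.1, p.2) (mcoeff p t).

Definition tensor_map (t : tensor A M) : tensor B M :=
  \pi_(Quotient.quot (@tensor_relb B M)) (tensor_lift (repr t)).

Lemma tensor_liftE (d : {fset (A * M)%type}) t : (msupp t `<=` d)%fset ->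
  tensor_lift t = \sum_(p <- d) mkmalgU (f p.1, p.2) (mcoeff p t).
Proof.
move=> td; rewrite /tensor_lift (big_fset_incl _ td) //= => p _.
by move=> /mcoeff_outdom ->; rewrite monalgU0.
Qed.

Lemma tensor_liftU p (n : int) :
  tensor_lift (mkmalgU p n) = mkmalgU (f p.1, p.2) n.
Proof. by rewrite (tensor_liftE (@msuppU_le _ _ _ _)) big_seq_fset1 mcoeffUU. Qed.

Lemma tensor_liftB : {morph tensor_lift : t u / t - u}.
Proof.
move=> t u.
rewrite (tensor_liftE (msuppB_le t u)) (tensor_liftE (fsubsetUl _ (msupp u))).
rewrite (tensor_liftE (fsubsetUr (msupp t) _)) -sumrB.
by apply/eq_bigr => p _; rewrite mcoeffB monalgUB.
Qed.

Lemma tensor_lift_relation t :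
  tensor_relation t -> tensor_relation (tensor_lift t).
Proof.
elim=> [|{}t u _ ht _ hu|a b m|a m n|s a m].
- by rewrite /tensor_lift msupp0 big_seq_fset0; exact: TensorZero.
- by rewrite tensor_liftB; exact: TensorSub.
- by rewrite !tensor_liftB !tensor_liftU /= raddfD; exact: TensorDl.
- by rewrite !tensor_liftB !tensor_liftU /=; exact: TensorDr.
- by rewrite !tensor_liftB !tensor_liftU /= linearZ; exact: TensorBalanced.
Qed.

Lemma tensor_map_pi t :
  tensor_map (\pi_(Quotient.quot (@tensor_relb A M)) t) =
  \pi_(Quotient.quot (@tensor_relb B M)) (tensor_lift t).
Proof.
apply/eqP; rewrite /tensor_map -Quotient.idealrBE -tensor_liftB.
apply/asboolP/tensor_lift_relation/asboolP.
have := Quotient.idealrBE (@tensor_relb A M)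
  (repr (\pi_(Quotient.quot (@tensor_relb A M)) t)) t.
by rewrite reprK eqxx.
Qed.

Lemma tensor_map_pure a m :
  tensor_map (tensor_pure a m) = tensor_pure (f a) m.
Proof. by rewrite tensor_map_pi tensor_liftU. Qed.

Lemma tensor_mapB : {morph tensor_map : t u / t - u}.
Proof.
elim/quotW=> t; elim/quotW=> u.
by rewrite !tensor_map_pi -!raddfB tensor_map_pi tensor_liftB.
Qed.

End Functoriality.
End Tensor.

Definition flat_module (S : pzRingType) (M : lmodType S) : Prop :=
  forall (A B : lmodType S^c) (f : {linear A -> B}),
  injective f -> injective (@tensor_map S A B M f).

Definition injective_module (S : pzRingType) (E : lmodType S) : Prop :=
  forall (A B : lmodType S) (f : {linear A -> B}) (g : {linear A -> E}),
  injective f -> exists h : {linear B -> E}, forall x, h (f x) = g x.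

Definition exact_at (S : pzRingType) (A B C : lmodType S)
    (f : {linear A -> B}) (g : {linear B -> C}) : Prop :=
  forall y, g y = 0 <-> exists x, f x = y.

(* 0 -> M -> E 0 -> ... -> E n -> 0; the complex is continued by zero modules. *)
Definition has_injective_resolution (S : pzRingType) (M : lmodType S) (n : nat) :
    Prop :=
  exists (E : nat -> lmodType S) (d : forall i, {linear E i -> E i.+1})
         (e : {linear M -> E 0%N}),
  [/\ injective e, exact_at e (d 0%N), forall i, exact_at (d i) (d i.+1),
      forall i, injective_module (E i)
    & forall i, (n < i)%N -> forall x : E i, x = 0].

(* 0 -> F n -> ... -> F 0 -> M -> 0; the complex is continued by zero modules. *)
Definition has_flat_resolution (S : pzRingType) (M : lmodType S) (n : nat) :
    Prop :=
  exists (F : nat -> lmodType S) (d : forall i, {linear F i.+1 -> F i})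
         (e : {linear F 0%N -> M}),
  [/\ forall y, exists x, e x = y, exact_at (d 0%N) e,
      forall i, exact_at (d i.+1) (d i),
      forall i, flat_module (F i)
    & forall i, (n < i)%N -> forall x : F i, x = 0].

(* The least natural number satisfying P, or +oo if there is none. *)
Definition least_nat (P : nat -> Prop) : \bar int :=
  if pselect (exists n, `[< P n >]) is left exP then (ex_minn exP)%:Z%:E
  else +oo%E.

Lemma least_nat_le (P : nat -> Prop) (n : nat) :
  (least_nat P <= n%:Z%:E)%E <-> exists2 m, (m <= n)%N & P m.
Proof.
rewrite /least_nat; case: pselect => [exP|nP].
  case: ex_minnP => m /asboolP Pm min_m; rewrite lee_fin lez_nat.
  split=> [mn|[k kn Pk]]; first by exists m.
  by apply: leq_trans kn; apply/min_m/asboolP.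
split=> [|[m _ Pm]]; first by rewrite leye_eq.
by case: nP; exists m; apply/asboolP.
Qed.

Definition injdim (S : pzRingType) (M : lmodType S) : \bar int :=
  least_nat (has_injective_resolution M).

Definition flatdim (S : pzRingType) (M : lmodType S) : \bar int :=
  least_nat (has_flat_resolution M).

(* A supremum of dimensions is the least natural number bounding all of them, *)
(* or +oo.                                                                    *)

Definition silf (S : pzRingType) : \bar int :=
  least_nat (fun n =>
    forall M : lmodType S, flat_module M -> (injdim M <= n%:Z%:E)%E).

Definition sfli (S : pzRingType) : \bar int :=
  least_nat (fun n =>
    forall M : lmodType S, injective_module M -> (flatdim M <= n%:Z%:E)%E).

Definition gorenstein (R : comPzRingType) : Prop :=
  left_noetherian R /\ (injdim R^o < +oo)%E.

(* Main.v *)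
(* Write S = RG. For a finitely generated right module N, with a resolution   *)
(* by finitely generated free modules, and an injective left module E one has *)
(* Tor_i(N, E) = Hom(Ext^i(N, S), E), and for N a finitely generated left     *)
(* module and M flat one has Ext^i(N, M) = Ext^i(N, S) (x) M. Hence, S being  *)
(* noetherian on both sides, sfli S is the self-injective dimension of S as a *)
(* right module and silf S that of S as a left module; the inversion of G     *)
(* makes S isomorphic to its converse ring, so that the two agree. Ext and    *)
(* Tor are handled through exact sequences of matrices over S.                *)

Require Import Defs.
From HB Require Import structures.
From mathcomp Require Import all_boot all_order all_algebra.
From mathcomp Require Import finmap boolp classical_sets constructive_ereal.
From mathcomp.multinomials Require Import -(notations) monalg.

Set Implicit Arguments.
Unset Strict Implicit.
Unset Printing Implicit Defensive.

Import Order.TTheory GRing.Theory Num.Theory.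

Local Open Scope ring_scope.
Local Open Scope quotient_scope.

(** Over a ring that is noetherian on the relevant side, resolutions of finitely generated modules
    continue by matrices, and homological conditions become solvability of linear systems.
    [rows_exact A B] is exactness of a sequence of free modules, and [exact_on X A B] is its
    exactness after applying Hom(-, X). Baer's criterion detects injectivity of [X] on such pairs,
    and character modules do the same for flatness ([exact_on_injective], [exact_on_flat], with
    converses [injective_exact_on], [flat_exact_on]). Dimension shifting, with enough injectives and
    free covers, then turns a bound n on an injective or flat dimension into the vanishing of
    Ext^(n+1)(-, X) or Tor_(n+1)(-, Y) on finitely generated modules ([injdim_le], [flatdim_le]).

    Transposition of matrices is the duality Hom(-, S) on finitely generated free modules. A dual
    sequence that is exact stays exact after tensoring with a flat module or applying Hom into an
    injective one. Hence n bounds the injective dimensions of all flat modules iff Ext^(n+1)(-, S)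
    vanishes on finitely generated left modules ([flat_injdim_le]), and n bounds the flat dimensions
    of all injective modules iff this holds for right modules ([injective_flatdim_le]).

    For S = RG with R commutative, inversion in G is an isomorphism of S with its converse ring. It
    makes S noetherian on the right too and identifies the two conditions for each n. So sfli and
    silf are the same least bound, which gives both claims. *)

(** * Submodules and quotients *)

Section Submodules.
Variables (T : pzRingType) (M : lmodType T).

Definition submodule (P : M -> Prop) : Prop :=
  [/\ P 0, forall x y, P x -> P y -> P (x + y) & forall a x, P x -> P (a *: x)].

Section Construction.
Variables (P : M -> Prop) (subP : submodule P).

(** The proof of [submodule P] is an argument so that the closure instance declared on this constant
    can depend on it. *)
Definition submodule_pred of submodule P : {pred M} := fun x => `[< P x >].

Fact submodule_pred_closed : submod_closed (submodule_pred subP).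
Proof.
have [P0 PD PZ] := subP; split; first exact/asboolP.
by move=> a x y /asboolP Px /asboolP Py; apply/asboolP/PD => //; exact: PZ.
Qed.

HB.instance Definition _ := GRing.isSubmodClosed.Build T M
  (submodule_pred subP) submodule_pred_closed.

Record submodule_type := SubmoduleElt {
  submodule_val :> M; _ : submodule_val \in submodule_pred subP }.

HB.instance Definition _ := [isSub for submodule_val].
HB.instance Definition _ := [Choice of submodule_type by <:].
HB.instance Definition _ := [SubChoice_isSubLmodule of submodule_type by <:].

(** Later proofs see submodules only through this interface, and quotients only through
    [quotient_exists]. *)
Lemma submodule_exists :
  exists (K : lmodType T) (i : {linear K -> M}),
    injective i /\ forall x, P x <-> exists k, i k = x.
Proof.
exists (submodule_type : lmodType T), (val : {linear submodule_type -> M}).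
split; first exact: val_inj.
move=> x; split=> [Px|[k <-]]; last by case: k => y /= /asboolP.
have Px' : x \in submodule_pred subP by apply/asboolP.
by exists (SubmoduleElt Px').
Qed.

Definition quotient_module : Type := Quotient.quot (submodule_pred subP).

HB.instance Definition _ := GRing.Zmodule.on quotient_module.

Local Notation piq := (\pi_(Quotient.quot (submodule_pred subP))).

Lemma quotient_module_eq x y : piq x = piq y <-> P (x - y).
Proof.
split=> [/eqP|Pxy]; first by rewrite -Quotient.idealrBE => /asboolP.
by apply/eqP; rewrite -Quotient.idealrBE; apply/asboolP.
Qed.

Definition quotient_scale (a : T) (u : quotient_module) : quotient_module :=
  piq (a *: repr u).

Lemma quotient_scale_pi a x : quotient_scale a (piq x) = piq (a *: x).
Proof.
apply/quotient_module_eq; rewrite -scalerBr; have [_ _ PZ] := subP; apply: PZ.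
by apply/quotient_module_eq; rewrite reprK.
Qed.

Fact quotient_scaleA a b u :
  quotient_scale a (quotient_scale b u) = quotient_scale (a * b) u.
Proof.
elim/quotW: u => x.
by rewrite (quotient_scale_pi b x) !quotient_scale_pi scalerA.
Qed.

Fact quotient_scale1 : left_id 1 quotient_scale.
Proof. by elim/quotW=> x; rewrite quotient_scale_pi scale1r. Qed.

Fact quotient_scaleDr : right_distributive quotient_scale +%R.
Proof.
move=> a; elim/quotW=> x; elim/quotW=> y.
by rewrite -raddfD !quotient_scale_pi -raddfD scalerDr.
Qed.

Fact quotient_scaleDl u : {morph quotient_scale^~ u : a b / a + b}.
Proof.
by elim/quotW: u => x a b; rewrite !quotient_scale_pi -raddfD scalerDl.
Qed.

HB.instance Definition _ := GRing.Zmodule_isLmodule.Build T quotient_module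
  quotient_scaleA quotient_scale1 quotient_scaleDr quotient_scaleDl.

Definition quotient_proj (x : M) : quotient_module := piq x.

Fact quotient_proj_is_linear : linear quotient_proj.
Proof.
by move=> a x y; rewrite /quotient_proj raddfD /= -quotient_scale_pi.
Qed.

HB.instance Definition _ := GRing.isLinear.Build T M quotient_module _
  quotient_proj quotient_proj_is_linear.

Lemma quotient_exists :
  exists (Q : lmodType T) (p : {linear M -> Q}),
    (forall u, exists x, p x = u) /\ forall x, p x = 0 <-> P x.
Proof.
exists (quotient_module : lmodType T), (quotient_proj : {linear _ -> _}).
split=> [|x]; first by elim/quotW=> x; exists x.
have -> : (quotient_proj x = 0) = (piq x = piq 0) by rewrite raddf0.
by rewrite quotient_module_eq subr0.
Qed.

End Construction.
End Submodules.

Lemma submodule_ker (T : pzRingType) (M N : lmodType T) (f : {linear M -> N}) :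
  submodule (fun x => f x = 0).
Proof.
split=> [|x y fx fy|a x fx]; first exact: linear0.
  by rewrite linearD fx fy addr0.
by rewrite linearZ /= fx scaler0.
Qed.

Lemma submodule_image (T : pzRingType) (M N : lmodType T)
    (f : {linear M -> N}) :
  submodule (fun y => exists x, f x = y).
Proof.
split=> [|_ _ [x <-] [y <-]|a _ [x <-]]; first by exists 0; rewrite linear0.
  by exists (x + y); rewrite linearD.
by exists (a *: x); rewrite linearZ.
Qed.

(** * Baer's criterion *)

Lemma linear_exists (T : pzRingType) (U V : lmodType T) (f : U -> V) :
  linear f -> exists h : {linear U -> V}, h =1 f.
Proof.
move=> f_lin; pose fL := GRing.isLinear.Build T U V *:%R f f_lin.
by exists (HB.pack_for {linear U -> V} f fL).
Qed.

Section Baer.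
Variables (T : pzRingType) (X : lmodType T).

(** A linear map out of a left ideal is encoded as a function on all of [T] whose linearity is
    required only on [I]. *)
Definition baer_condition : Prop :=
  forall (I : T -> Prop) (phi : T -> X), left_ideal I ->
  (forall a x y, I x -> I y -> phi (a * x + y) = a *: phi x + phi y) ->
  exists u, forall x, I x -> phi x = x *: u.

Section Extension.
Variables (A B : lmodType T) (f : {linear A -> B}) (g : {linear A -> X}).
Hypothesis baer : baer_condition.
Hypothesis fg : forall x, f x = 0 -> g x = 0.

(** Nonempty such sets are the graphs of linear maps on submodules of [B] that extend [g] along [f].
    The last clause is conditional so that the empty set qualifies, being the union of the empty
    chain in [Zorn_bigcup]. *)
Definition partial_extension (G : set (B * X)) : Prop :=
  [/\ forall p q, G p -> G q -> G (p + q), forall a p, G p -> G (a *: p),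
      forall x, G (0, x) -> x = 0 & forall p, G p -> forall a, G (f a, g a)].

Lemma partial_extension_graph :
  partial_extension [set p | exists a, p = (f a, g a)].
Proof.
split=> /=.
- by move=> _ _ [a ->] [b ->]; exists (a + b); rewrite !raddfD.
- by move=> c _ [a ->]; exists (c *: a); rewrite !linearZ.
- by move=> x [a [/esym/fg fa0 ->]].
- by move=> _ _ a; exists a.
Qed.

Lemma partial_extension_maximal : exists2 G : set (B * X),
  partial_extension G /\ (forall a, G (f a, g a)) &
  forall G', (G `<=` G')%classic -> partial_extension G' -> (G' `<=` G)%classic.
Proof.
have [|G [PG maxG]] := @Zorn_bigcup _ partial_extension.
  move=> F FP Ftot.
  split=> [p q [G FG Gp] [H FH Hq]|a p [G FG Gp]|x [G FG G0]|].
  - have [GH|HG] := Ftot _ _ FG FH.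
      by exists H => //; have [HD _ _ _] := FP _ FH; apply: HD => //; exact: GH.
    by exists G => //; have [HD _ _ _] := FP _ FG; apply: HD => //; exact: HG.
  - by exists G => //; have [_ HZ _ _] := FP _ FG; exact: HZ.
  - by have [_ _ H0 _] := FP _ FG; exact: H0.
  - move=> p [G FG Gp] a; exists G => //.
    by have [_ _ _ Hf] := FP _ FG; exact: Hf Gp a.
(* An empty [G] would be strictly contained in the graph given by [f] and [g], against
   maximality. *)
have [p Gp] : exists p, G p.
  apply: contrapT => nG; apply: (maxG _ _ partial_extension_graph).
  split=> [p Gp|sG]; first by case: nG; exists p.
  by apply: nG; exists (f 0, g 0); apply: sG; exists 0.
have [_ _ _ Gf] := PG; exists G; first by split=> //; exact: Gf Gp.
move=> G' GG' PG'; apply: contrapT => nG'G.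
by apply: (maxG G') => //; split.
Qed.

Lemma baer_extension : exists h : {linear B -> X}, forall x, h (f x) = g x.
Proof.
have [G [PG Gfg] maxG] := partial_extension_maximal.
have [GD GZ G0 _] := PG.
have GB p q : G p -> G q -> G (p - q).
  by move=> Gp Gq; rewrite -scaleN1r; apply/GD/GZ.
have G00 : G (0, 0) by rewrite -(linear0 f) -(linear0 g).
have Gfun b x y : G (b, x) -> G (b, y) -> x = y.
  move=> Gx Gy; apply/subr0_eq/G0.
  by have := GB _ _ Gx Gy; congr G; congr pair; rewrite /= subrr.
(* The scalars moving [b] into the domain of [G] form an ideal [I], on which t |-> G(t b) is linear.
   Baer's condition writes it as t |-> t u, so adjoining the multiples of (b, u) to [G] still gives
   a functional graph, and maximality puts (b, u) in [G]. *)
have Gtot b : exists x, G (b, x).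
  pose I t := exists x, G (t *: b, x).
  have /choice[phi Gphi] (t : T) : exists x, I t -> G (t *: b, x).
    have [[x Gx]|nI] := EM (I t); first by exists x.
    by exists 0.
  have I_ideal : left_ideal I.
    split; first by exists 0; rewrite scale0r.
      move=> s t [x Gx] [y Gy]; exists (x + y); rewrite scalerDl.
      exact: (GD _ _ Gx Gy).
    by move=> a s [x Gx]; exists (a *: x); rewrite -scalerA; exact: (GZ a _ Gx).
  have [|u phiE] := baer I_ideal (phi := phi).
    move=> a s t Is It; have [_ ID IZ] := I_ideal.
    apply: (Gfun ((a * s + t) *: b)); first by apply/Gphi/ID => //; exact: IZ.
    rewrite scalerDl -scalerA.
    exact: (GD _ _ (GZ a _ (Gphi _ Is)) (Gphi _ It)).
  pose G' (p : B * X) : Prop := exists t : T, G (p - t *: ((b, u) : B * X)).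
  exists u; apply: (maxG G'); last by exists 1; rewrite scale1r subrr.
    by move=> p Gp; exists 0; rewrite scale0r subr0.
  split.
  - move=> p q [s Gs] [t Gt]; exists (s + t).
    by rewrite scalerDl opprD addrACA; exact: GD.
  - by move=> a p [s Gs]; exists (a * s); rewrite -scalerA -scalerBr; exact: GZ.
  - move=> x [t Gt].
    have Gt' : G (t *: b, t *: u - x).
      by have := GZ (-1) _ Gt; congr G; rewrite scaleN1r; congr pair;
        rewrite /= opprB ?subr0.
    have It : I t by exists (t *: u - x).
    have := Gfun _ _ _ Gt' (Gphi _ It); rewrite phiE // => /eqP.
    by rewrite subr_eq addrC -subr_eq subrr => /eqP.
  - by move=> _ _ a; exists 0; rewrite scale0r subr0.
have [h Gh] := choice Gtot.
have [|k kE] := @linear_exists T B X h.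
  move=> a x y; apply: (Gfun (a *: x + y)); first exact: Gh.
  exact: (GD _ _ (GZ a _ (Gh x)) (Gh y)).
by exists k => x; rewrite kE; apply: (Gfun (f x)).
Qed.

End Extension.

Lemma baer_injective : baer_condition -> injective_module X.
Proof.
move=> baer A B f g f_inj; apply: baer_extension => // x fx0.
by have -> : x = 0; [apply: f_inj; rewrite fx0 linear0|rewrite linear0].
Qed.

End Baer.

(** Both maps descend to the quotient of [A] by the kernel of [f], where [f] becomes injective. *)
Lemma injective_factor (T : pzRingType) (E A B : lmodType T)
    (f : {linear A -> B}) (g : {linear A -> E}) :
  injective_module E -> (forall x, f x = 0 -> g x = 0) ->
  exists h : {linear B -> E}, forall x, h (f x) = g x.
Proof.
move=> injE fg.
have [Q [p [p_surj p_ker]]] := quotient_exists (submodule_ker f).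
have [r rK] := choice p_surj.
have rp x : f (x - r (p x)) = 0 by apply/p_ker; rewrite linearB rK subrr.
have rpE (C : lmodType T) (k : {linear A -> C}) :
    (forall x, f x = 0 -> k x = 0) -> forall x, k (r (p x)) = k x.
  by move=> fk x; apply/esym/subr0_eq; rewrite -linearB; exact/fk/rp.
have desc (C : lmodType T) (k : {linear A -> C}) :
    (forall x, f x = 0 -> k x = 0) ->
    exists k' : {linear Q -> C}, forall x, k' (p x) = k x.
  move=> fk; have [|k' k'E] := @linear_exists T Q C (k \o r).
    move=> a u v /=; rewrite -linearP -[RHS](rpE _ _ fk).
    by rewrite linearP !rK.
  by exists k' => x; rewrite k'E /= rpE.
have [f' f'E] := desc _ f (fun _ => id); have [g' g'E] := desc _ g fg.
have f'_inj : injective f'.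
  move=> u v; have [x <-] := p_surj u; have [y <-] := p_surj v.
  by rewrite !f'E => fxy; apply/subr0_eq; rewrite -linearB; apply/p_ker;
    rewrite linearB fxy subrr.
have [h hE] := injE _ _ f' g' f'_inj.
by exists h => x; rewrite -f'E hE g'E.
Qed.

(** * Divisible groups *)

Lemma additive_exists (U V : zmodType) (f : U -> V) :
  {morph f : x y / x + y} -> exists h : {additive U -> V}, h =1 f.
Proof.
move=> fD; have f0 : f 0 = 0 by apply: (addIr (f 0)); rewrite -fD !add0r.
have fB : {morph f : x y / x - y}.
  by move=> x y; apply: (addIr (f y)); rewrite -fD !subrK.
pose fA := GRing.isZmodMorphism.Build U V f fB.
by exists (HB.pack_for {additive U -> V} f fA).
Qed.

Definition divisible (D : zmodType) : Prop :=
  forall (n : nat) (x : D), (0 < n)%N -> exists y, y *+ n = x.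

Lemma int_ideal_principal (I : int -> Prop) : left_ideal I ->
  exists n : nat, I n /\ forall x, I x -> (n %| x)%Z.
Proof.
move=> [I0 ID IM].
have [[m [m_gt0 Im]]|nI] := EM (exists m : nat, (0 < m)%N /\ I m); last first.
  exists 0%N; split=> // x Ix; rewrite dvd0z; apply: contra_notT nI => x0.
  exists `|x|%N; rewrite absz_gt0; split=> //.
  by rewrite abszE normrEsg; exact: IM.
have exP : exists m, `[< (0 < m)%N /\ I (m : nat) >] by exists m; apply/asboolP.
case: (ex_minnP exP) => n /asboolP[n_gt0 In] min_n.
exists n; split=> // x Ix; apply/dvdz_mod0P.
have n0 : (n : int) != 0 by rewrite eqz_nat -lt0n.
have Ir : I (x %% n)%Z.
  by rewrite /modz -mulNr; apply: ID => //; exact: IM.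
have r_ge0 : 0 <= (x %% n)%Z by exact: modz_ge0.
have rE : (x %% n)%Z = `|(x %% n)%Z|%N by rewrite gez0_abs.
have : (`|(x %% n)%Z| < n)%N by rewrite -ltz_nat -rE ltz_pmod.
have [r0 _|r_gt0] := posnP `|(x %% n)%Z|%N; first by rewrite rE r0.
by rewrite ltnNge min_n //; apply/asboolP; split=> //; rewrite -rE.
Qed.

(** An ideal of the integers is generated by some [n], and a linear map on it extends by dividing
    its value at [n] by [n]. *)
Lemma divisible_baer (D : zmodType) : divisible D -> baer_condition (zmodule D).
Proof.
move=> divD I phi I_ideal phi_lin; have [I0 _ _] := I_ideal.
have [n [In nI]] := int_ideal_principal I_ideal.
have phi0 : phi 0 = 0.
  by have := phi_lin (-1) 0 0 I0 I0; rewrite mulr0 addr0 scaleN1r addNr.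
have phiM a x : I x -> phi (a * x) = a *: phi x.
  by move=> Ix; have := phi_lin a x 0 Ix I0; rewrite phi0 !addr0.
have [u uE] : exists u : zmodule D, phi n = (n : int) *: u.
  have [n0|n_gt0] := posnP n; first by exists 0; rewrite n0 phi0 scaler0.
  have [y yE] := divD n (phi n) n_gt0; exists y.
  by rewrite scalezrE -pmulrn yE.
exists u => x Ix; have /dvdzP[q ->] := nI x Ix.
by rewrite phiM // uE scalerA.
Qed.

Lemma divisible_factor (U V D : zmodType) (f : {additive U -> V})
    (g : {additive U -> D}) :
  divisible D -> (forall x, f x = 0 -> g x = 0) ->
  exists h : {additive V -> D}, forall x, h (f x) = g x.
Proof.
move=> divD fg.
have add_lin (W Z : zmodType) (k : {additive W -> Z}) :
    linear (k : zmodule W -> zmodule Z).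
  by move=> a x y; rewrite !scalezrE raddfD raddfMz.
have [f' f'E] := linear_exists (add_lin _ _ f).
have [g' g'E] := linear_exists (add_lin _ _ g).
have [|h hE] := @baer_extension int (zmodule D) _ _ f' g' (divisible_baer divD).
  by move=> x; rewrite f'E g'E; exact: fg.
have [|k kE] := @additive_exists V D h; first by move=> x y; exact: (raddfD h).
by exists k => x; rewrite kE -g'E -hE f'E.
Qed.

Section LiftMalg.
Variables (K : choiceType) (Z : zmodType) (phi : K -> Z).

Lemma malg_lift_exists :
  exists h : {additive malg K int -> Z}, forall p, h (mkmalgU p 1) = phi p.
Proof.
pose h (z : malg K int) := \sum_(p <- msupp z) phi p *~ mcoeff p z.
have hE (d : {fset K}) z : (msupp z `<=` d)%fset ->
    h z = \sum_(p <- d) phi p *~ mcoeff p z.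
  move=> zd; rewrite /h (big_fset_incl _ zd) //= => p _.
  by move=> /mcoeff_outdom ->; rewrite mulr0z.
have [|k kE] := @additive_exists (malg K int) Z h.
  move=> z w; rewrite (hE _ _ (msuppD_le z w)) (hE _ _ (fsubsetUl _ (msupp w))).
  rewrite (hE _ _ (fsubsetUr (msupp z) _)) -big_split /=.
  by apply/eq_bigr => p _; rewrite mcoeffD mulrzDr.
exists k => p; rewrite kE (hE _ _ (@msuppU_le _ _ _ _)) big_seq_fset1 mcoeffUU.
by rewrite mulr1z.
Qed.

End LiftMalg.

(** [M] is the free abelian group on its own elements modulo the kernel of [ev]. Allowing rational
    coefficients while dividing by the same kernel gives a divisible group that contains it. *)
Lemma divisible_embedding (M : zmodType) :
  exists (D : zmodType) (i : {additive M -> D}), divisible D /\ injective i.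
Proof.
have [ev evE] := @malg_lift_exists M M id.
pose V : zmodType := malg M rat.
pose P (v : zmodule V) := exists2 z : malg M int,
  forall p, mcoeff p (v : V) = (mcoeff p z)%:~R & ev z = 0.
have subP : submodule P.
  split=> [|u v [z zE z0] [w wE w0]|a u [z zE z0]].
  - by exists 0; rewrite ?raddf0 // => p; rewrite !mcoeff0.
  - exists (z + w); last by rewrite raddfD z0 w0 addr0.
    move=> p; transitivity (mcoeff p (u : V) + mcoeff p (v : V)).
      exact: mcoeffD.
    by rewrite mcoeffD intrD; exact: (congr2 +%R (zE p) (wE p)).
  - exists (z *~ a); last by rewrite raddfMz z0 mul0rz.
    move=> p; transitivity (mcoeff p (u : V) *~ a); first exact: raddfMz.
    by rewrite raddfMz [RHS]rmorphMz /=; congr (_ *~ a); exact: zE.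
have [Q [pr [pr_surj pr_ker]]] := quotient_exists subP.
have [|i iE] := @additive_exists M Q (fun m => pr (mkmalgU m (1 : rat) : V)).
  move=> m n; apply/subr0_eq; rewrite -raddfD -raddfB; apply/pr_ker.
  exists (mkmalgU (m + n) 1 - (mkmalgU m 1 + mkmalgU n 1)).
    by move=> p; rewrite !(mcoeffB, mcoeffD) !mcoeffU !raddfB !raddfD !raddfMn.
  by rewrite raddfB raddfD !evE subrr.
exists Q, i; split.
  move=> n q n_gt0; have [v <-] := pr_surj q.
  pose w : V := \sum_(p <- msupp (v : V)) mkmalgU p (mcoeff p (v : V) / n%:R).
  exists (pr w).
  rewrite -raddfMn; congr (pr _); rewrite [RHS](monalgE (v : V)) -sumrMnl.
  apply/eq_bigr => p _; rewrite -raddfMn /= -[_ / _ *+ _]mulr_natr divfK //.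
  by rewrite pnatr_eq0 -lt0n.
apply: raddf_inj => m; rewrite iE => /pr_ker[z zE].
have -> : z = mkmalgU m 1.
  apply/malgP => p; apply: (@intr_inj rat); rewrite -zE !mcoeffU.
  by rewrite raddfMn.
by rewrite evE.
Qed.

(** * Enough injectives *)

Section AdditiveHom.
Variables (Y D : zmodType).

Definition additive_pred : {pred Y -> D} :=
  fun f => `[< {morph f : x y / x + y} >].

Record additive_hom := AdditiveHom {
  additive_hom_val :> Y -> D; _ : additive_hom_val \in additive_pred }.

HB.instance Definition _ := [isSub for additive_hom_val].
HB.instance Definition _ := gen_eqMixin additive_hom.
HB.instance Definition _ := gen_choiceMixin additive_hom.

Lemma additive_homP (f : additive_hom) : {morph f : x y / x + y}.
Proof. by case: f => f /= /asboolP. Qed.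

Lemma additive_hom_ext (f g : additive_hom) : f =1 g -> f = g.
Proof. by move=> fg; apply/val_inj/funext. Qed.

Lemma additive_hom_exists (f : Y -> D) : {morph f : x y / x + y} ->
  exists h : additive_hom, h =1 f.
Proof.
move=> fD; have fP : f \in additive_pred by apply/asboolP.
by exists (AdditiveHom fP).
Qed.

Fact additive_hom_zero_subproof : (fun=> 0) \in additive_pred.
Proof. by apply/asboolP=> x y; rewrite addr0. Qed.

Fact additive_hom_opp_subproof (f : additive_hom) :
  (fun y => - f y) \in additive_pred.
Proof. by apply/asboolP=> x y; rewrite additive_homP opprD. Qed.

Fact additive_hom_add_subproof (f g : additive_hom) :
  (fun y => f y + g y) \in additive_pred.
Proof. by apply/asboolP=> x y; rewrite !additive_homP addrACA. Qed.

Let hom0 := AdditiveHom additive_hom_zero_subproof.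
Let homN f := AdditiveHom (additive_hom_opp_subproof f).
Let homD f g := AdditiveHom (additive_hom_add_subproof f g).

Fact additive_hom_addA : associative homD.
Proof. by move=> f g h; apply/additive_hom_ext => y; rewrite /= addrA. Qed.

Fact additive_hom_addC : commutative homD.
Proof. by move=> f g; apply/additive_hom_ext => y; rewrite /= addrC. Qed.

Fact additive_hom_add0 : left_id hom0 homD.
Proof. by move=> f; apply/additive_hom_ext => y; rewrite /= add0r. Qed.

Fact additive_hom_addN : left_inverse hom0 homN homD.
Proof. by move=> f; apply/additive_hom_ext => y; rewrite /= addNr. Qed.

HB.instance Definition _ := GRing.isZmodule.Build additive_hom
  additive_hom_addA additive_hom_addC additive_hom_add0 additive_hom_addN.

(* The order of composition makes [additive_hom] a left [T]-module. *)
Definition right_action (T : pzRingType) (r : T -> Y -> Y) : Prop :=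
  [/\ forall s, {morph r s : x y / x + y},
      forall s t y, r (s + t) y = r s y + r t y,
      forall y, r 1 y = y & forall s t y, r (s * t) y = r t (r s y)].

Section Action.
Variables (T : pzRingType) (r : T -> Y -> Y) (rP : right_action r).

Definition coinduced of right_action r : Type := additive_hom.

HB.instance Definition _ := GRing.Zmodule.on (coinduced rP).

Fact coinduced_scale_subproof (s : T) (f : additive_hom) :
  f \o r s \in additive_pred.
Proof.
have [rD _ _ _] := rP.
by apply/asboolP=> x y; rewrite /= rD additive_homP.
Qed.

Definition coinduced_scale (s : T) (f : coinduced rP) : coinduced rP :=
  AdditiveHom (coinduced_scale_subproof s f).

Fact coinduced_scaleA s t f :
  coinduced_scale s (coinduced_scale t f) = coinduced_scale (s * t) f.
Proof.
by have [_ _ _ rM] := rP; apply/additive_hom_ext => y; rewrite /= rM.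
Qed.

Fact coinduced_scale1 : left_id 1 coinduced_scale.
Proof.
by have [_ _ r1 _] := rP; move=> f; apply/additive_hom_ext => y; rewrite /= r1.
Qed.

Fact coinduced_scaleDr : right_distributive coinduced_scale +%R.
Proof. by move=> s f g; apply/additive_hom_ext. Qed.

Fact coinduced_scaleDl f : {morph coinduced_scale^~ f : s t / s + t}.
Proof.
have [_ rD _ _] := rP; move=> s t; apply/additive_hom_ext => y.
by rewrite /= rD additive_homP.
Qed.

HB.instance Definition _ := GRing.Zmodule_isLmodule.Build T (coinduced rP)
  coinduced_scaleA coinduced_scale1 coinduced_scaleDr coinduced_scaleDl.

(** Serves twice: with [Y] the ring it gives injective modules, and with [Y] a module it gives the
    character module. *)
Lemma coinduced_exists :
  exists (H : lmodType T) (ev : H -> Y -> D),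
    [/\ forall h, {morph ev h : x y / x + y},
        forall h k y, ev (h + k) y = ev h y + ev k y,
        forall s h y, ev (s *: h) y = ev h (r s y),
        forall h k, ev h =1 ev k -> h = k
      & forall f : Y -> D, {morph f : x y / x + y} -> exists h, ev h =1 f].
Proof.
exists (coinduced rP : lmodType T), (fun h => additive_hom_val h).
split=> //; [exact: additive_homP|exact: additive_hom_ext|].
exact: additive_hom_exists.
Qed.

End Action.
End AdditiveHom.

Section EnoughInjectives.
Variable T : pzRingType.

(** By adjunction, linear maps from [A] to Hom(T, D) are additive maps from [A] to [D], read off by
    evaluation at 1, and these extend because [D] is divisible. *)
Lemma coinduced_injective (D : zmodType) : divisible D ->
  forall (H : lmodType T) (ev : H -> T -> D),
  (forall h, {morph ev h : x y / x + y}) ->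
  (forall h k y, ev (h + k) y = ev h y + ev k y) ->
  (forall s h y, ev (s *: h) y = ev h (y * s)) ->
  (forall h k, ev h =1 ev k -> h = k) ->
  (forall f : T -> D, {morph f : x y / x + y} -> exists h, ev h =1 f) ->
  injective_module H.
Proof.
move=> divD H ev evD evDl evZ ev_inj ev_surj A B f g f_inj.
have [|g1 g1E] := @additive_exists A D (fun a => ev (g a) 1).
  by move=> x y; rewrite raddfD evDl.
have [|h1 h1E] := @divisible_factor A B D f g1 divD.
  move=> x fx0; have -> : x = 0 by apply: f_inj; rewrite fx0 raddf0.
  exact: raddf0.
have /choice[h hE] (b : B) : exists h : H, forall t, ev h t = h1 (t *: b).
  by apply: ev_surj => s t; rewrite scalerDl raddfD.
have [|k kE] := @linear_exists T B H h.
  move=> a x y; apply: ev_inj => t.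
  by rewrite evDl evZ !hE scalerDr scalerA raddfD.
exists k => a; rewrite kE; apply: ev_inj => t.
by rewrite hE -linearZ h1E g1E linearZ /= evZ mul1r.
Qed.

(** With [M] inside a divisible group by [j], send [m] to t |-> j(t m); evaluation at 1 shows
    injectivity. *)
Lemma enough_injectives (M : lmodType T) :
  exists (E : lmodType T) (i : {linear M -> E}),
    injective_module E /\ injective i.
Proof.
have [D [j [divD j_inj]]] := divisible_embedding M.
have actT : right_action (fun s t : T => t * s).
  by split=> [s x y|s t y|y|s t y]; rewrite ?mulrDl ?mulrDr ?mulr1 ?mulrA.
have [E [ev [evD evDl evZ ev_inj ev_surj]]] := coinduced_exists D actT.
have /choice[i iE] (m : M) : exists h : E, forall t, ev h t = j (t *: m).
  by apply: ev_surj => s t; rewrite scalerDl raddfD.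
have [|k kE] := @linear_exists T M E i.
  move=> a x y; apply: ev_inj => t.
  by rewrite evDl evZ !iE scalerDr scalerA raddfD.
exists E, k; split; first exact: (coinduced_injective divD).
move=> x y; rewrite !kE => ixy; apply: j_inj.
by rewrite -[x]scale1r -[y]scale1r -!iE ixy.
Qed.

End EnoughInjectives.

(** * Resolutions by matrices *)

Section Action.
Variable T : pzRingType.
Implicit Types X Y : lmodType T.

(** Under Hom(T^k, X) = X^k this is composition with [w |-> w *m A]. For [A] over the converse ring,
    [act] of the transpose of [A] is the map induced by [A] on tensor products with [X]. *)
Definition act X m n (A : 'M[T]_(m, n)) (u : {ffun 'I_n -> X}) :
    {ffun 'I_m -> X} :=
  [ffun i => \sum_j A i j *: u j].

Lemma actD X m n (A : 'M[T]_(m, n)) :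
  {morph @act X m n A : u v / u + v}.
Proof.
move=> u v; apply/ffunP=> i; rewrite !ffunE -big_split /=.
by apply/eq_bigr => j _; rewrite ffunE scalerDr.
Qed.

Lemma act0 X m n (A : 'M[T]_(m, n)) : act A (0 : {ffun 'I_n -> X}) = 0.
Proof. by apply: (addIr (act A 0)); rewrite -actD !add0r. Qed.

Lemma actB X m n (A : 'M[T]_(m, n)) :
  {morph @act X m n A : u v / u - v}.
Proof. by move=> u v; apply: (addIr (act A v)); rewrite -actD !subrK. Qed.

Lemma act0m X m n (u : {ffun 'I_n -> X}) : act (0 : 'M_(m, n)) u = 0.
Proof.
apply/ffunP=> i; rewrite !ffunE big1 // => j _.
by rewrite mxE scale0r.
Qed.

Lemma act_mul X m n p (A : 'M[T]_(m, n)) (B : 'M_(n, p))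
    (u : {ffun 'I_p -> X}) :
  act (A *m B) u = act A (act B u).
Proof.
apply/ffunP=> i; rewrite !ffunE.
under [RHS]eq_bigr => j _ do rewrite ffunE scaler_sumr.
rewrite exchange_big /=; apply/eq_bigr => k _.
by rewrite mxE scaler_suml; apply/eq_bigr => j _; rewrite scalerA.
Qed.

Lemma act_linear X Y (f : {linear X -> Y}) m n (A : 'M[T]_(m, n))
    (u : {ffun 'I_n -> X}) :
  act A [ffun i => f (u i)] = [ffun i => f (act A u i)].
Proof.
apply/ffunP=> i; rewrite !ffunE linear_sum /=.
by apply/eq_bigr => j _; rewrite ffunE linearZ.
Qed.

(** Only the inclusion of the kernel in the image is asked; the other one comes from
    [B *m A = 0]. *)
Definition exact_on X k0 k1 k2 (A : 'M[T]_(k1, k0)) (B : 'M[T]_(k2, k1)) :=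
  forall v : {ffun 'I_k1 -> X}, act B v = 0 -> exists u, act A u = v.

Definition rows_exact k0 k1 k2 (A : 'M[T]_(k1, k0)) (B : 'M[T]_(k2, k1)) :=
  forall w : 'rV[T]_k1, w *m A = 0 <-> exists c, w = c *m B.

Lemma rows_exact_mul k0 k1 k2 (A : 'M[T]_(k1, k0)) (B : 'M[T]_(k2, k1)) :
  rows_exact A B -> B *m A = 0.
Proof.
move=> exAB; apply/row_matrixP=> i; rewrite row_mul row0.
by apply/exAB; exists (delta_mx 0 i); rewrite -rowE.
Qed.

(* [0 -> X -> Y -> Z -> 0] below is exact; both lemmas are connecting maps in *)
(* the long exact sequence.                                                   *)
Section DimensionShift.
Variables (X Y Z : lmodType T) (f : {linear X -> Y}) (g : {linear Y -> Z}).
Hypotheses (f_inj : injective f) (fg : exact_at f g).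
Hypothesis g_surj : forall z, exists y, g y = z.

Lemma ffun_lift k (z : {ffun 'I_k -> Z}) :
  exists y : {ffun 'I_k -> Y}, [ffun i => g (y i)] = z.
Proof.
have /choice[y yE] (i : 'I_k) := g_surj (z i).
by exists (finfun y); apply/ffunP=> i; rewrite !ffunE yE.
Qed.

Lemma ffun_ker k (y : {ffun 'I_k -> Y}) : [ffun i => g (y i)] = 0 ->
  exists x : {ffun 'I_k -> X}, [ffun i => f (x i)] = y.
Proof.
move=> /ffunP gy0.
have /choice[x xE] (i : 'I_k) : exists x, f x = y i.
  by apply/fg; have := gy0 i; rewrite !ffunE.
by exists (finfun x); apply/ffunP=> i; rewrite !ffunE xE.
Qed.

Lemma ffun_comp0 k (x : {ffun 'I_k -> X}) : [ffun i => g (f (x i))] = 0.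
Proof. by apply/ffunP=> i; rewrite !ffunE; apply/fg; exists (x i). Qed.

Lemma ffun_inj k (x y : {ffun 'I_k -> X}) :
  [ffun i => f (x i)] = [ffun i => f (y i)] -> x = y.
Proof.
move=> /ffunP fxy; apply/ffunP=> i; apply: f_inj.
by have := fxy i; rewrite !ffunE.
Qed.

Variables (k0 k1 k2 k3 : nat).
Variables (A : 'M[T]_(k1, k0)) (B : 'M[T]_(k2, k1)) (C : 'M[T]_(k3, k2)).

Lemma exact_on_shift_left :
  B *m A = 0 -> exact_on Z A B -> exact_on Y B C -> exact_on X B C.
Proof.
move=> BA0 exZ exY v Cv0.
have [|y yE] := exY [ffun i => f (v i)].
  rewrite act_linear Cv0; apply/ffunP=> i; by rewrite !ffunE linear0.
have [|z zE] := exZ [ffun i => g (y i)].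
  rewrite act_linear yE -(ffun_comp0 v); apply/ffunP=> i; by rewrite !ffunE.
have [t tE] := ffun_lift z.
(* The image of [y] in [Z] is [act A z], so subtracting [act A t], with [t] a lift of [z], brings
   [y] into [X] without changing its image under [B]. *)
have [|x xE] := @ffun_ker _ (y - act A t).
  have := act_linear g A t; rewrite tE zE => /ffunP gE.
  apply/ffunP=> i; have := gE i; rewrite !ffunE linearB /= => ->.
  by rewrite subrr.
exists x; apply/ffun_inj; rewrite -[RHS]yE -act_linear xE actB.
by rewrite -act_mul BA0 act0m subr0.
Qed.

Lemma exact_on_shift_right :
  C *m B = 0 -> exact_on X B C -> exact_on Y A B -> exact_on Z A B.
Proof.
move=> CB0 exX exY v Bv0.
have [y yE] := ffun_lift v.
(* The connecting map: [act B y] comes from [X] and is killed by [C], hence equals [act B w] with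
   [w] in [X]. Then [y] minus [w] is a lift of [v] killed by [B]. *)
have [|x xE] := @ffun_ker _ (act B y); first by rewrite -act_linear yE.
have [|w wE] := exX x.
  apply/ffun_inj; rewrite -act_linear xE -act_mul CB0 act0m.
  by apply/ffunP=> i; rewrite !ffunE linear0.
have [|u uE] := exY (y - [ffun i => f (w i)]).
  by rewrite actB act_linear wE xE subrr.
exists [ffun i => g (u i)]; rewrite act_linear uE -[RHS]yE.
apply/ffunP=> i; rewrite !ffunE linearB /=.
by have /ffunP/(_ i) := ffun_comp0 w; rewrite !ffunE => ->; rewrite subr0.
Qed.

End DimensionShift.

(** A tuple [v] killed by [B] is a map T^k1 -> E vanishing on the rows of [B], that is, on the
    kernel of [A]. It therefore factors through [A], and the values of the factor on the basis form
    the solution. *)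
Lemma injective_exact_on (E : lmodType T) k0 k1 k2 (A : 'M[T]_(k1, k0))
    (B : 'M[T]_(k2, k1)) :
  injective_module E -> rows_exact A B -> exact_on E A B.
Proof.
move=> injE exAB v Bv0.
have [|g gE] := @linear_exists T 'rV[T]_k1 E (fun w => \sum_i w 0 i *: v i).
  move=> a w z; rewrite scaler_sumr -big_split /=; apply/eq_bigr => i _.
  by rewrite !mxE scalerDl scalerA.
have [|f fE] := @linear_exists T 'rV[T]_k1 'rV[T]_k0 (mulmx^~ A).
  by move=> a w z; rewrite mulmxDl scalemxAl.
have [|h hE] := injective_factor (f := f) (g := g) injE.
  move=> w; rewrite fE gE => /exAB[c ->].
  under eq_bigr => i _ do rewrite mxE scaler_suml.
  rewrite exchange_big /= big1 // => j _.
  under eq_bigr => i _ do rewrite -scalerA.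
  by rewrite -scaler_sumr; have /ffunP/(_ j) := Bv0; rewrite !ffunE => ->;
    rewrite scaler0.
exists [ffun j => h (delta_mx 0 j)]; apply/ffunP=> i; rewrite !ffunE.
have gEi : g (delta_mx 0 i) = v i.
  rewrite gE (bigD1 i) //= mxE !eqxx scale1r big1 ?addr0 // => j /negPf ji.
  by rewrite mxE ji andbF scale0r.
rewrite -gEi -hE fE -rowE [row i A]row_sum_delta linear_sum /=.
by apply/eq_bigr => j _; rewrite ffunE linearZ /= mxE.
Qed.

Lemma left_ideal_gen (I : T -> Prop) (s : seq T) :
  (forall x, I x <-> exists c : nat -> T, x = \sum_(i < size s) c i * s`_i) ->
  forall i : 'I_(size s), I s`_i.
Proof.
move=> sE i; apply/sE; exists (fun j => (j == i :> nat)%:R).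
rewrite (bigD1 i) //= eqxx mul1r big1 ?addr0 // => j /negPf ji.
by rewrite (_ : (j == i :> nat) = false) ?mul0r.
Qed.

(** Induction on [k]: the first coordinates of [N] form a left ideal, and the elements with first
    coordinate 0 a submodule of rank-[k] rows. Generators of both, the former lifted to [N],
    generate [N]. *)
Lemma row_submodule_fg : left_noetherian T ->
  forall k (N : 'rV[T]_k -> Prop), submodule N ->
  exists m (B : 'M[T]_(m, k)), forall w, N w <-> exists c, w = c *m B.
Proof.
move=> noethT; elim=> [N [N0 _ _]|k IHk].
  exists 0%N, 0 => w; split=> [_|_]; last by rewrite [w]thinmx0.
  by exists 0; rewrite [RHS]thinmx0 [LHS]thinmx0.
rewrite -[k.+1]/(1 + k)%N => N [N0 ND NZ].
pose I t := exists w : 'rV[T]_k, N (row_mx t%:M w).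
have I_ideal : left_ideal I.
  split; first by exists 0; rewrite raddf0 row_mx0.
    move=> s t [v Nv] [w Nw]; exists (v + w).
    by rewrite raddfD -add_row_mx; exact: ND.
  move=> a s [v Nv]; exists (a *: v).
  by rewrite -scale_scalar_mx -scale_row_mx; exact: NZ.
have [s sE] := noethT _ I_ideal.
have [|m [B BE]] := IHk (fun w => N (row_mx 0 w)).
  split=> [|v w Nv Nw|a v Nv]; first by rewrite row_mx0.
    by rewrite -[0](addr0 0) -add_row_mx; exact: ND.
  by rewrite -[0](scaler0 _ a) -scale_row_mx; exact: NZ.
have /choice[r rE] (i : 'I_(size s)) : exists w, N (row_mx (s`_i)%:M w).
  exact: (left_ideal_gen sE).
pose R : 'M[T]_(size s, 1 + k) := \matrix_i row_mx (s`_i)%:M (r i).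
have NR c : N (c *m R).
  rewrite mulmx_sum_row; elim/big_ind: _ => // i _.
  by apply: NZ; rewrite rowK.
exists (size s + m)%N, (col_mx R (row_mx 0 B)) => w.
split=> [Nw|[c ->]]; last first.
  rewrite -[c]hsubmxK mul_row_col; apply: ND; first exact: NR.
  by rewrite mul_mx_row mulmx0; apply/BE; exists (rsubmx c).
have [c cE] : exists c : nat -> T, lsubmx w 0 0 = \sum_(i < size s) c i * s`_i.
  by apply/sE; exists (rsubmx w); rewrite -mx11_scalar hsubmxK.
pose v := w - (\row_i c i) *m R.
have Nv : N v.
  by rewrite /v -scaleN1r; apply: ND => //; apply: NZ; exact: NR.
have v0 : lsubmx v = 0.
  rewrite /v linearB /=; apply/eqP.
  rewrite subr_eq0; apply/eqP/matrixP=> i j; rewrite !ord1 cE !mxE.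
  apply/eq_bigr => l _; rewrite !mxE.
  by rewrite (unsplitK (inl 0)) mxE eqxx mulr1n.
have [|d dE] := (BE (rsubmx v)).1; first by rewrite -v0 hsubmxK.
exists (row_mx (\row_i c i) d); rewrite mul_row_col mul_mx_row mulmx0 -dE -v0.
by rewrite hsubmxK /v addrC subrK.
Qed.

Lemma rows_exact_extend : left_noetherian T ->
  forall k0 k1 (A : 'M[T]_(k1, k0)),
  exists k2 (B : 'M[T]_(k2, k1)), rows_exact A B.
Proof.
move=> noethT k0 k1 A; apply: (row_submodule_fg noethT).
split=> [|v w vA wA|a v vA]; first by rewrite mul0mx.
  by rewrite mulmxDl vA wA addr0.
by rewrite -scalemxAl vA scaler0.
Qed.

(** Baer's criterion: take [A] the column of generators of the ideal and [B] their relations. The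
    values of [phi] on the generators satisfy [B], so exactness makes them multiples of one
    element. *)
Lemma exact_on_injective X : left_noetherian T ->
  (forall k0 k1 k2 (A : 'M[T]_(k1, k0)) (B : 'M[T]_(k2, k1)),
     rows_exact A B -> exact_on X A B) ->
  injective_module X.
Proof.
move=> noethT exX; apply: baer_injective => I phi I_ideal phi_lin.
have [I0 ID IM] := I_ideal; have [s sE] := noethT _ I_ideal.
have phi0 : phi 0 = 0.
  by have := phi_lin (-1) 0 0 I0 I0; rewrite mulr0 addr0 scaleN1r addNr.
have Is (i : 'I_(size s)) : I s`_i by exact: (left_ideal_gen sE).
have phi_sum (c : 'I_(size s) -> T) :
    phi (\sum_i c i * s`_i) = \sum_i c i *: phi s`_i.
  apply: proj2 (_ : I _ /\ _); apply: (big_rec2 (fun x y => I x /\ phi x = y)).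
    by rewrite phi0.
  move=> i x y _ [Ix <-]; rewrite phi_lin //; split=> //.
  by apply/ID => //; exact: IM.
pose A : 'M[T]_(size s, 1) := \col_i s`_i.
have [k [B exAB]] := rows_exact_extend noethT A.
have [|u uE] := exX _ _ _ A B exAB [ffun i : 'I_(size s) => phi s`_i].
  apply/ffunP=> j; rewrite !ffunE.
  under eq_bigr => i _ do rewrite ffunE.
  rewrite -(phi_sum (B j)) -[RHS]phi0; congr phi.
  transitivity ((B *m A) j 0); last by rewrite (rows_exact_mul exAB) mxE.
  by rewrite mxE; apply: eq_bigr => i _; rewrite mxE.
exists (u 0) => x /sE[c ->]; rewrite phi_sum scaler_suml.
apply/eq_bigr => i _; rewrite -scalerA; congr (_ *: _).
by have /ffunP/(_ i) := uE; rewrite !ffunE big_ord1 mxE => <-.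
Qed.

(** Exactness at n+1 consecutive places, continuing beyond [A]: [A] and [B] are the differentials of
    degrees n+1 and n+2 in the start of a free resolution of the cokernel of the last matrix. *)
Fixpoint syzygies n k0 k1 k2 (A : 'M[T]_(k1, k0)) (B : 'M[T]_(k2, k1)) : Prop :=
  rows_exact A B /\
  if n is n'.+1 then exists k (A' : 'M[T]_(k0, k)), syzygies n' A' A else True.

Lemma syzygies_rows_exact n k0 k1 k2 (A : 'M[T]_(k1, k0)) (B : 'M[T]_(k2, k1)) :
  syzygies n A B -> rows_exact A B.
Proof. by case: n => [|n] []. Qed.

(* [Ext^(n+1)(N, X) = 0] for all finitely generated modules [N]. *)
Definition ext_vanishes n X : Prop :=
  forall k0 k1 k2 (A : 'M[T]_(k1, k0)) (B : 'M[T]_(k2, k1)),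
  syzygies n A B -> exact_on X A B.

End Action.

(** * Flatness *)

Section TensorProduct.
Variables (S : pzRingType) (A : lmodType S^c) (M : lmodType S).

Local Notation pit := (\pi_(Quotient.quot (@tensor_relb S A M))).

Lemma tensor_relationP t : tensor_relation t -> pit t = 0.
Proof.
move=> rel_t; rewrite -(raddf0 pit); apply/eqP.
by rewrite -Quotient.idealrBE subr0; apply/asboolP.
Qed.

Lemma tensor_pureDl (m : M) : {morph (@tensor_pure S A M)^~ m : a b / a + b}.
Proof.
move=> a b; apply/subr0_eq; rewrite opprD addrA -!raddfB.
exact/tensor_relationP/TensorDl.
Qed.

Lemma tensor_pureDr (a : A) : {morph @tensor_pure S A M a : m n / m + n}.
Proof.
move=> m n; apply/subr0_eq; rewrite opprD addrA -!raddfB.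
exact/tensor_relationP/TensorDr.
Qed.

Lemma tensor_pureZ (s : S) (a : A) (m : M) :
  tensor_pure ((s : S^c) *: a) m = tensor_pure a (s *: m).
Proof.
apply/subr0_eq; rewrite -raddfB.
exact/tensor_relationP/TensorBalanced.
Qed.

Lemma tensor_pure0l (m : M) : tensor_pure (0 : A) m = 0.
Proof. by apply: (addIr (tensor_pure 0 m)); rewrite -tensor_pureDl !add0r. Qed.

Lemma tensor_pure0r (a : A) : tensor_pure a (0 : M) = 0.
Proof. by apply: (addIr (tensor_pure a 0)); rewrite -tensor_pureDr !add0r. Qed.

Lemma tensor_pure_suml n (a : 'I_n -> A) (m : M) :
  tensor_pure (\sum_i a i) m = \sum_i tensor_pure (a i) m.
Proof. exact: (big_morph _ (tensor_pureDl m) (tensor_pure0l m)). Qed.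

Lemma tensor_pure_sumr n (a : A) (m : 'I_n -> M) :
  tensor_pure a (\sum_i m i) = \sum_i tensor_pure a (m i).
Proof. exact: (big_morph _ (tensor_pureDr a) (tensor_pure0r a)). Qed.

Lemma tensor_additive_ext (Z : zmodType) (h k : {additive tensor A M -> Z}) :
  (forall a m, h (tensor_pure a m) = k (tensor_pure a m)) -> h =1 k.
Proof.
move=> hk; elim/quotW=> t; rewrite (monalgE t) !raddf_sum /=.
apply: eq_bigr => -[a m] _.
have -> : mkmalgU (a, m) (mcoeff (a, m) t) =
    mkmalgU (a, m) 1 *~ mcoeff (a, m) t.
  by rewrite -raddfMz /= intz.
by rewrite !raddfMz; congr (_ *~ _); exact: hk.
Qed.

Lemma tensor_lift_exists (Z : zmodType) (phi : A -> M -> Z) :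
  (forall m, {morph phi^~ m : a b / a + b}) ->
  (forall a, {morph phi a : m n / m + n}) ->
  (forall (s : S) a m, phi ((s : S^c) *: a) m = phi a (s *: m)) ->
  exists h : {additive tensor A M -> Z},
    forall a m, h (tensor_pure a m) = phi a m.
Proof.
move=> phiDl phiDr phiZ.
have [ev evE] := malg_lift_exists (fun p : (A * M)%type => phi p.1 p.2).
have ev_rel t : tensor_relation t -> ev t = 0.
  elim=> [|{}t u _ ht _ hu|a b m|a m n|s a m]; first exact: raddf0.
  - by rewrite raddfB ht hu subrr.
  - by rewrite !raddfB !evE /= phiDl addrAC addrK subrr.
  - by rewrite !raddfB !evE /= phiDr addrAC addrK subrr.
  - by rewrite !raddfB !evE /= phiZ subrr.
have ev_pi t : ev (repr (pit t)) = ev t.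
  apply/subr0_eq; rewrite -raddfB; apply/ev_rel/asboolP.
  by have := Quotient.idealrBE (@tensor_relb S A M) (repr (pit t)) t;
    rewrite reprK eqxx.
have [|h hE] := @additive_exists (tensor A M) Z (fun t => ev (repr t)).
  by elim/quotW=> t; elim/quotW=> u; rewrite -raddfD !ev_pi raddfD.
by exists h => a m; rewrite hE ev_pi evE.
Qed.

Lemma tensor_map0 (B : lmodType S^c) (f : {linear A -> B}) :
  tensor_map f (0 : tensor A M) = 0.
Proof. by rewrite -(subrr 0) tensor_mapB subrr. Qed.

Lemma tensor_mapD (B : lmodType S^c) (f : {linear A -> B}) :
  {morph @tensor_map S A B M f : t u / t + u}.
Proof.
move=> t u; rewrite -[u in LHS]opprK -[- u]add0r !tensor_mapB tensor_map0.
by rewrite add0r opprK.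
Qed.

End TensorProduct.

Section Flatness.
Variable S : pzRingType.
Implicit Types Y : lmodType S.

Lemma trmx_mulc m n p (A : 'M[S^c]_(m, n)) (B : 'M[S^c]_(n, p)) :
  (A *m B)^T = (B^T : 'M[S]_(p, n)) *m (A^T : 'M[S]_(n, m)).
Proof.
by apply/matrixP=> i j; rewrite !mxE; apply: eq_bigr => k _; rewrite !mxE.
Qed.

(** * Character modules Hom(Y, D) *)

Section Character.
Variables (Y : lmodType S) (D : zmodType) (H : lmodType S^c) (ev : H -> Y -> D).
Hypotheses (divD : divisible D)
  (evD : forall h, {morph ev h : x y / x + y})
  (evDl : forall h k y, ev (h + k) y = ev h y + ev k y)
  (evZ : forall (s : S^c) h y, ev (s *: h) y = ev h ((s : S) *: y))
  (ev_inj : forall h k, ev h =1 ev k -> h = k)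
  (ev_surj : forall f : Y -> D, {morph f : x y / x + y} -> exists h, ev h =1 f).

Let ev0 h : ev h 0 = 0.
Proof. by apply: (addIr (ev h 0)); rewrite -evD !add0r. Qed.

Let ev0l y : ev 0 y = 0.
Proof. by apply: (addIr (ev 0 y)); rewrite -evDl !add0r. Qed.

Let ev_sumr n h (y : 'I_n -> Y) : ev h (\sum_i y i) = \sum_i ev h (y i).
Proof. exact: (big_morph _ (evD h) (ev0 h)). Qed.

Let ev_suml n (h : 'I_n -> H) y : ev (\sum_i h i) y = \sum_i ev (h i) y.
Proof. exact: (big_morph (ev^~ y) (fun _ _ => evDl _ _ _) (ev0l y)). Qed.

Definition ffun_single k (i : 'I_k) (y : Y) : {ffun 'I_k -> Y} :=
  [ffun l => y *+ (l == i)].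

Lemma ffun_singleD k (i : 'I_k) : {morph ffun_single i : x y / x + y}.
Proof. by move=> x y; apply/ffunP=> l; rewrite !ffunE mulrnDl. Qed.

Lemma act_single m n (A : 'M[S]_(m, n)) (i : 'I_n) y :
  act A (ffun_single i y) = \sum_j ffun_single j (A j i *: y).
Proof.
apply/ffunP=> l; rewrite sum_ffunE !ffunE (bigD1 i) //= ffunE eqxx mulr1n.
rewrite big1 ?addr0 => [|j /negPf ji]; last by rewrite ffunE ji scaler0.
rewrite (bigD1 l) //= ffunE eqxx big1 ?addr0 // => j jl.
by rewrite ffunE eq_sym (negPf jl).
Qed.

(** Hom(-, D) is exact for divisible [D]: a tuple killed by [B] is an additive map Y^k1 -> D
    vanishing on the image of the transpose of [B], hence it factors through the transpose of
    [A]. *)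
Lemma character_exact_on k0 k1 k2 (A : 'M[S^c]_(k1, k0))
    (B : 'M[S^c]_(k2, k1)) :
  exact_on Y (B^T : 'M[S]_(k1, k2)) (A^T : 'M[S]_(k0, k1)) -> exact_on H A B.
Proof.
move=> exY phi Bphi0.
have [|Phi PhiE] := @additive_exists {ffun 'I_k1 -> Y} D
    (fun y => \sum_i ev (phi i) (y i)).
  by move=> x y; rewrite -big_split; apply: eq_bigr => i _; rewrite ffunE evD.
have [|f fE] := @additive_exists {ffun 'I_k1 -> Y} {ffun 'I_k0 -> Y}
    (act (A^T : 'M[S]_(k0, k1))).
  exact: actD.
have [|Psi PsiE] := @divisible_factor _ _ _ f Phi divD.
  move=> y; rewrite fE => /exY[z <-]; rewrite PhiE.
  under eq_bigr => i _ do rewrite ffunE ev_sumr.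
  rewrite exchange_big /= big1 // => j _.
  transitivity (ev (act B phi j) (z j)); last by rewrite Bphi0 ffunE ev0l.
  by rewrite ffunE ev_suml; apply: eq_bigr => i _; rewrite evZ mxE.
have /choice[u uE] (j : 'I_k0) :
    exists h, forall y, ev h y = Psi (ffun_single j y).
  by apply: ev_surj => x y; rewrite ffun_singleD raddfD.
exists (finfun u); apply/ffunP=> i; apply: ev_inj => y; rewrite ffunE ev_suml.
have -> : ev (phi i) y = Phi (ffun_single i y).
  rewrite PhiE (bigD1 i) //= ffunE eqxx mulr1n big1 ?addr0 // => j /negPf ji.
  by rewrite ffunE ji ev0.
rewrite -PsiE fE act_single raddf_sum; apply: eq_bigr => j _.
by rewrite ffunE evZ uE mxE.
Qed.

End Character.

(* Lambek: the character module of [Y] is injective, so a nonzero element of  *)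
(* a tensor product survives in any larger one.                               *)
Lemma exact_on_flat Y : left_noetherian S^c ->
  (forall k0 k1 k2 (A : 'M[S^c]_(k1, k0)) (B : 'M[S^c]_(k2, k1)),
     rows_exact A B ->
     exact_on Y (B^T : 'M[S]_(k1, k2)) (A^T : 'M[S]_(k0, k1))) ->
  flat_module Y.
Proof.
move=> noethS exY A B f f_inj.
have [|fY fYE] := @additive_exists _ _ (@tensor_map S A B Y f).
  exact: tensor_mapD.
suff fY_inj : injective fY by move=> x y; rewrite -!fYE; exact: fY_inj.
apply: raddf_inj => t ft0.
have [D [chi [divD chi_inj]]] := divisible_embedding (tensor A Y).
have actY : right_action (fun (s : S^c) (y : Y) => (s : S) *: y).
  split=> [s x y|s r y|y|s r y]; rewrite ?scalerDr ?scalerDl ?scale1r //.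
  by rewrite scalerA.
have [H [ev [evD evDl evZ ev_inj ev_surj]]] := coinduced_exists D actY.
have injH : injective_module H.
  apply: (exact_on_injective noethS) => k0 k1 k2 P Q /exY.
  exact: (character_exact_on divD).
(* By adjunction [chi] becomes a map [A -> H]. Its extension [h] to [B] corresponds to [k] on
   [tensor B Y] with [k \o fY = chi], so [fY t = 0] forces [chi t = 0]. *)
have /choice[g gE] (a : A) : exists h, forall y, ev h y = chi (tensor_pure a y).
  by apply: ev_surj => x y; rewrite tensor_pureDr raddfD.
have [|gL gLE] := @linear_exists S^c A H g.
  move=> s a b; apply: ev_inj => y.
  by rewrite evDl evZ !gE tensor_pureDl tensor_pureZ raddfD.
have [h hE] := injH _ _ f gL f_inj.
have [||s b y|k kE] := @tensor_lift_exists S B Y D (fun b y => ev (h b) y).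
- by move=> y a b; rewrite linearD evDl.
- by move=> b; exact: evD.
- by rewrite linearZ /= evZ.
have [|l lE] := @additive_exists (tensor A Y) D (fun x => k (fY x)).
  by move=> x y; rewrite !raddfD.
apply: chi_inj; rewrite raddf0 -(@tensor_additive_ext S A Y D l chi).
  by rewrite lE ft0 raddf0.
by move=> a y; rewrite lE fYE tensor_map_pure kE hE gLE gE.
Qed.

(** Let [N] be the right module generated by the rows of [A]. By flatness the sum of the [n j]
    tensored with [y j] vanishes in [tensor N Y], since it does over the ambient free module. The
    map [h] from [tensor N Y] to the cokernel [Q] of the transpose of [B] sends it to the class of
    [y]. *)
Lemma flat_exact_on Y k0 k1 k2 (A : 'M[S^c]_(k1, k0)) (B : 'M[S^c]_(k2, k1)) :
  flat_module Y -> rows_exact A B ->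
  exact_on Y (B^T : 'M[S]_(k1, k2)) (A^T : 'M[S]_(k0, k1)).
Proof.
move=> flatY exAB y Ay0.
pose V : zmodType := {ffun 'I_k1 -> Y}.
pose P (v : zmodule V) := exists z, act (B^T : 'M[S]_(k1, k2)) z = v.
have subP : submodule P.
  split; first by exists 0; rewrite act0.
    by move=> _ _ [z <-] [w <-]; exists (z + w); rewrite actD.
  move=> a _ [z <-]; exists (z *~ a).
  have [|f fE] := @additive_exists _ V (@act S Y _ _ (B^T : 'M[S]_(k1, k2))).
    exact: actD.
  by rewrite scalezrE -!fE raddfMz.
have [Q [pr [_ pr_ker]]] := quotient_exists subP.
pose sc (c : 'rV[S^c]_k1) (x : Y) : V := [ffun i => (c 0 i : S) *: x].
have scD c d x : sc (c + d) x = sc c x + sc d x.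
  by apply/ffunP=> i; rewrite !ffunE mxE scalerDl.
have scDr c x x' : sc c (x + x') = sc c x + sc c x'.
  by apply/ffunP=> i; rewrite !ffunE scalerDr.
(* The rows of [B] span the kernel of [A], so this class depends only on [c *m A]. This makes [h]
   well defined although preimages in [N] are chosen arbitrarily. *)
have pr_sc c d x : c *m A = d *m A -> pr (sc c x) = pr (sc d x).
  move=> cd; apply/subr0_eq; rewrite -raddfB; apply/pr_ker.
  have /exAB[e eE] : (c - d) *m A = 0 by rewrite mulmxBl cd subrr.
  exists [ffun j => (e 0 j : S) *: x]; transitivity (sc (c - d) x); last first.
    by apply: (addIr (sc d x)); rewrite -scD !subrK.
  apply/ffunP=> i; rewrite !ffunE eE mxE scaler_suml.
  by apply: eq_bigr => j _; rewrite ffunE scalerA mxE.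
pose inA (x : 'rV[S^c]_k0) := exists c, c *m A = x.
have sub_inA : submodule inA.
  split; first by exists 0; rewrite mul0mx.
    by move=> _ _ [c <-] [d <-]; exists (c + d); rewrite mulmxDl.
  by move=> a _ [c <-]; exists (a *: c); rewrite scalemxAl.
have [N [i [i_inj iE]]] := submodule_exists sub_inA.
have /choice[c cE] (n : N) : exists c, c *m A = i n by apply/iE; exists n.
have /choice[n nE] (j : 'I_k1) : exists n, i n = row j A.
  by apply/iE; exists (delta_mx 0 j); rewrite -rowE.
have [|||h hE] := @tensor_lift_exists S N Y Q (fun a x => pr (sc (c a) x)).
- move=> x a b; transitivity (pr (sc (c a + c b) x)).
    by apply: pr_sc; rewrite mulmxDl !cE linearD.
  by rewrite scD raddfD.
- by move=> a x x'; rewrite scDr raddfD.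
- move=> s a x; transitivity (pr (sc ((s : S^c) *: c a) x)).
    by apply: pr_sc; rewrite -scalemxAl !cE linearZ.
  by congr (pr _); apply/ffunP=> j; rewrite !ffunE mxE scalerA.
pose t : tensor N Y := \sum_j tensor_pure (n j) (y j).
have t0 : t = 0.
  apply: (flatY _ _ i i_inj).
  rewrite tensor_map0 /t (big_morph _ (tensor_mapD i) (tensor_map0 Y i)).
  transitivity (\sum_j \sum_l
    tensor_pure (delta_mx 0 l : 'rV[S^c]_k0) ((A j l : S) *: y j)).
    apply: eq_bigr => j _; rewrite tensor_map_pure nE [row j A]row_sum_delta.
    rewrite tensor_pure_suml; apply: eq_bigr => l _.
    by rewrite tensor_pureZ mxE.
  rewrite exchange_big /= big1 // => l _; rewrite -tensor_pure_sumr.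
  have /ffunP/(_ l) := Ay0; rewrite !ffunE.
  by under eq_bigr => j _ do rewrite mxE; move=> ->; rewrite tensor_pure0r.
apply/pr_ker; have := congr1 h t0; rewrite raddf0 raddf_sum => <-.
transitivity (pr (\sum_j sc (delta_mx 0 j) (y j))); last first.
  rewrite raddf_sum; apply: eq_bigr => j _; rewrite hE; apply: pr_sc.
  by rewrite cE nE rowE.
congr (pr _); apply/ffunP=> l; rewrite sum_ffunE (bigD1 l) //= ffunE mxE !eqxx.
rewrite scale1r big1 ?addr0 // => j /negPf jl.
by rewrite ffunE mxE eq_sym jl andbF scale0r.
Qed.

(* [Tor_(n+1)(N, Y) = 0] for all finitely generated right modules [N]. *)
Definition tor_vanishes n Y : Prop :=
  forall k0 k1 k2 (A : 'M[S^c]_(k1, k0)) (B : 'M[S^c]_(k2, k1)),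
  syzygies n A B -> exact_on Y (B^T : 'M[S]_(k1, k2)) (A^T : 'M[S]_(k0, k1)).

End Flatness.

(** * Injective and flat dimensions *)

Section Resolutions.
Variable T : pzRingType.

Lemma linear_corestrict (K L M : lmodType T) (i : {linear K -> M})
    (f : {linear L -> M}) :
  injective i -> (forall x, exists k, i k = f x) ->
  exists g : {linear L -> K}, forall x, i (g x) = f x.
Proof.
move=> i_inj /choice[g gE].
have [|h hE] := @linear_exists T L K g.
  by move=> a x y; apply: i_inj; rewrite linearP !gE linearP.
by exists h => x; rewrite hE.
Qed.

Lemma exact_on_iso (X Y : lmodType T) (f : {linear X -> Y}) k0 k1 k2
    (A : 'M[T]_(k1, k0)) (B : 'M[T]_(k2, k1)) :
  injective f -> (forall y, exists x, f x = y) ->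
  exact_on X A B <-> exact_on Y A B.
Proof.
move=> f_inj f_surj; split=> exX v Bv0.
  have [x xE] := ffun_lift f_surj v.
  have [|u uE] := exX x.
    apply: (ffun_inj f_inj); rewrite -act_linear xE Bv0.
    by apply/ffunP=> i; rewrite !ffunE linear0.
  by exists [ffun i => f (u i)]; rewrite act_linear uE.
have [|y yE] := exX [ffun i => f (v i)].
  by rewrite act_linear Bv0; apply/ffunP=> i; rewrite !ffunE linear0.
have [u uE] := ffun_lift f_surj y.
by exists u; apply: (ffun_inj f_inj); rewrite -act_linear uE.
Qed.

(** * Injective dimension through vanishing of Ext *)

Section Injective.
Hypothesis noethT : left_noetherian T.

(** Since Ext(-, E) vanishes in positive degrees, Ext^(n+2)(-, X) = Ext^(n+1)(-, Z). Passing from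
    [X] to [Z] needs one more matrix of syzygies, which the noetherian hypothesis supplies. *)
Lemma ext_vanishes_shift (X E Z : lmodType T) (f : {linear X -> E})
    (g : {linear E -> Z}) n :
  injective f -> exact_at f g -> (forall z, exists y, g y = z) ->
  injective_module E -> ext_vanishes n.+1 X <-> ext_vanishes n Z.
Proof.
move=> f_inj fg g_surj injE; split=> [exX k0 k1 k2 A B AB|exZ k0 k1 k2 A B].
  have exAB := syzygies_rows_exact AB.
  have [k3 [C exBC]] := rows_exact_extend noethT B.
  apply: (exact_on_shift_right f_inj fg g_surj (rows_exact_mul exBC)).
    by apply: exX; split=> //; exists k0, A.
  exact: injective_exact_on.
move=> [exAB [k [A' A'A]]]; have exA'A := syzygies_rows_exact A'A.
apply: (exact_on_shift_left f_inj fg g_surj (rows_exact_mul exA'A)).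
  exact: exZ.
exact: injective_exact_on.
Qed.

Lemma injective_resolution_ext_vanishes n (X : lmodType T) :
  has_injective_resolution X n -> ext_vanishes n X.
Proof.
elim: n X => [|n IHn] X [E [d [e [e_inj ed dd injE E0]]]].
  move=> k0 k1 k2 A B [exAB _]; apply/(exact_on_iso A B e_inj).
    by move=> y; apply/ed; exact: E0.
  exact: injective_exact_on.
(* [K] is the image of [d 0], that is, the cokernel of [e]; the truncated complex resolves it in
   length [n]. *)
have [K [i [i_inj iE]]] := submodule_exists (submodule_ker (d 1%N)).
have [|g gE] := linear_corestrict (f := d 0%N) i_inj.
  by move=> x; apply/iE/dd; exists x.
apply/(ext_vanishes_shift (f := e) (g := g)) => //.
- move=> y; rewrite -ed -gE; split=> [->|]; first exact: linear0.
  by rewrite -(linear0 i) => /i_inj.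
- move=> z; have [x xE] : exists x, d 0%N x = i z by apply/dd/iE; exists z.
  by exists x; apply: i_inj; rewrite gE.
apply: IHn; exists (fun j => E j.+1), (fun j => d j.+1), i; split=> //.
  by move=> j jn; exact: E0.
Qed.

Lemma zero_module_injective : injective_module ('rV[T]_0 : lmodType T).
Proof.
by move=> A B f g _; exists \0 => x; rewrite [LHS]thinmx0 [RHS]thinmx0.
Qed.

Lemma ext_vanishes_injective_resolution n (X : lmodType T) :
  ext_vanishes n X -> has_injective_resolution X n.
Proof.
elim: n X => [|n IHn] X exX.
  have injX : injective_module X.
    by apply: (exact_on_injective noethT) => k0 k1 k2 A B exAB; exact: exX.
  pose E i : lmodType T := if i is 0%N then X else 'rV[T]_0.
  exists E, (fun=> \0), idfun; split=> //.
  - by move=> y; split=> // _; exists y.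
  - move=> i y; split=> // _; exists 0.
    by rewrite [LHS](thinmx0 (_ : 'rV_0)) [RHS](thinmx0 (_ : 'rV_0)).
  - by case=> // i; exact: zero_module_injective.
  - by case=> // i _ x; exact: (thinmx0 (x : 'rV_0)).
have [E [e [injE e_inj]]] := enough_injectives X.
have [Z [p [p_surj p_ker]]] := quotient_exists (submodule_image e).
have ep : exact_at e p by [].
have /IHn[F [d [f [f_inj fd dd injF F0]]]] : ext_vanishes n Z.
  exact/(ext_vanishes_shift n e_inj ep p_surj injE).
pose E' i : lmodType T := if i is j.+1 then F j else E.
pose d' i : {linear E' i -> E' i.+1} :=
  match i with 0%N => f \o p | j.+1 => d j end.
exists E', d', e; split=> //.
- move=> y; rewrite -ep /=; split=> [|->]; last exact: linear0.
  by rewrite -(linear0 f) => /f_inj.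
- case=> [|i]; last exact: dd.
  move=> y; rewrite /= fd; split=> [[z <-]|[x <-]]; last by exists (p x).
  by have [x <-] := p_surj z; exists x.
- by case.
- by case=> // i; exact: F0.
Qed.

Lemma injdim_le n (X : lmodType T) :
  (injdim X <= n%:Z%:E)%E <-> ext_vanishes n X.
Proof.
rewrite least_nat_le; split=> [[m mn [E [d [e [e_inj ed dd injE E0]]]]]|exX].
  apply: injective_resolution_ext_vanishes; exists E, d, e; split=> // i ni.
  exact/E0/(leq_ltn_trans mn).
by exists n => //; exact: ext_vanishes_injective_resolution.
Qed.

End Injective.
End Resolutions.

(** * Free modules on arbitrary sets *)

Section FreeModule.
Variables (S : pzRingType) (K : choiceType).

Definition free_module : Type := malg K S.

HB.instance Definition _ := GRing.Zmodule.on free_module.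

Definition free_scale (a : S) (u : free_module) : free_module :=
  \sum_(x <- msupp u) mkmalgU x (a * mcoeff x u).

Lemma mcoeff_sumU (d : {fset K}) (c : K -> S) x :
  mcoeff x (\sum_(y <- d) mkmalgU y (c y)) = if x \in d then c x else 0.
Proof.
rewrite raddf_sum /=; case: ifPn => xd.
  rewrite (big_fsetD1 x) //= mcoeffUU big1_fset ?addr0 // => y.
  by rewrite in_fsetD1 mcoeffU => /andP[/negPf->].
rewrite big1_fset // => y yd _; rewrite mcoeffU.
by case: eqP yd xd => // -> ->.
Qed.

Lemma free_scaleE a u x : mcoeff x (free_scale a u) = a * mcoeff x u.
Proof.
rewrite mcoeff_sumU; case: ifPn => // xu.
by rewrite (mcoeff_outdom xu) mulr0.
Qed.

Fact free_scaleA a b u : free_scale a (free_scale b u) = free_scale (a * b) u.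
Proof. by apply/malgP=> x; rewrite !free_scaleE mulrA. Qed.

Fact free_scale1 : left_id 1 free_scale.
Proof. by move=> u; apply/malgP=> x; rewrite free_scaleE mul1r. Qed.

Fact free_scaleDr : right_distributive free_scale +%R.
Proof.
by move=> a u v; apply/malgP=> x; rewrite !(mcoeffD, free_scaleE) mulrDr.
Qed.

Fact free_scaleDl u : {morph free_scale^~ u : a b / a + b}.
Proof.
by move=> a b; apply/malgP=> x; rewrite !(mcoeffD, free_scaleE) mulrDl.
Qed.

HB.instance Definition _ := GRing.Zmodule_isLmodule.Build S free_module
  free_scaleA free_scale1 free_scaleDr free_scaleDl.

Lemma free_module_lift (Y : lmodType S) (phi : K -> Y) :
  exists h : {linear free_module -> Y}, forall x, h (mkmalgU x 1) = phi x.
Proof.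
pose h (u : free_module) := \sum_(x <- msupp u) mcoeff x u *: phi x.
have hE (d : {fset K}) (u : free_module) : (msupp u `<=` d)%fset ->
    h u = \sum_(x <- d) mcoeff x u *: phi x.
  move=> ud; rewrite /h (big_fset_incl _ ud) //= => x _.
  by move=> /mcoeff_outdom ->; rewrite scale0r.
have [|k kE] := @linear_exists S free_module Y h.
  move=> a u v; pose d := (msupp (a *: u + v) `|` (msupp u `|` msupp v))%fset.
  rewrite (hE d) ?(hE d u) ?(hE d v) ?fsubsetUl //; last 2 first.
  - by rewrite fsubsetU // fsubsetUr orbT.
  - by rewrite fsubsetU // fsubsetUl orbT.
  rewrite scaler_sumr -big_split /=; apply: eq_bigr => x _.
  by rewrite mcoeffD free_scaleE scalerDl scalerA.
exists k => x; rewrite kE (hE _ _ (@msuppU_le _ _ _ _)) big_seq_fset1 mcoeffUU.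
by rewrite scale1r.
Qed.

(** Coefficientwise, the system is the exactness of the rows. The solutions are kept only over the
    finite union [d] of the supports, outside which [y] vanishes. *)
Lemma free_module_exact_on k0 k1 k2 (A : 'M[S^c]_(k1, k0))
    (B : 'M[S^c]_(k2, k1)) :
  rows_exact A B ->
  exact_on free_module (B^T : 'M[S]_(k1, k2)) (A^T : 'M[S]_(k0, k1)).
Proof.
move=> exAB y Ay0.
have /choice[c cE] (x : K) : exists c : 'rV[S^c]_k2,
    \row_i (mcoeff x (y i) : S^c) = c *m B.
  apply/exAB/matrixP=> i j; rewrite !mxE.
  transitivity (mcoeff x (act (A^T : 'M[S]_(k0, k1)) y j)); last first.
    by rewrite Ay0 ffunE mcoeff0.
  rewrite ffunE raddf_sum; apply: eq_bigr => l _.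
  by rewrite [RHS]free_scaleE !mxE.
pose d : {fset K} :=
  [fset x in flatten [seq (msupp (y i) : seq K) | i : 'I_k1]]%fset.
exists [ffun j => \sum_(x <- d) mkmalgU x (c x 0 j : S) : free_module].
apply/ffunP=> i; apply/malgP=> x; rewrite ffunE raddf_sum /=.
transitivity (\sum_j if x \in d then (B j i : S) * (c x 0 j : S) else 0).
  apply: eq_bigr => j _; rewrite free_scaleE ffunE mcoeff_sumU mxE.
  by case: (x \in d); rewrite ?mulr0.
have -> : mcoeff x (y i) = (c x *m B) 0 i by rewrite -cE mxE.
have [xd|xd] := boolP (x \in d); first by rewrite mxE; apply: eq_bigr.
rewrite big1 //.
rewrite -cE mxE mcoeff_outdom //; apply: contra xd => xy.
by rewrite inE /=; apply/flatten_imageP; exists i.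
Qed.

End FreeModule.

(** * Flat dimension through vanishing of Tor *)

Section FlatResolutions.
Variable S : pzRingType.
Hypothesis noethS : left_noetherian S^c.

Lemma flat_cover (Y : lmodType S) :
  exists (F : lmodType S) (p : {linear F -> Y}),
    flat_module F /\ forall y, exists x, p x = y.
Proof.
have [p pE] := free_module_lift (fun y : Y => y).
exists (free_module S Y : lmodType S), p; split; last first.
  by move=> y; exists (mkmalgU y 1).
by apply: (exact_on_flat noethS) => k0 k1 k2 A B; exact: free_module_exact_on.
Qed.

(** Tor_(n+2)(-, Z) = Tor_(n+1)(-, X), because [F] is flat. *)
Lemma tor_vanishes_shift (X F Z : lmodType S) (f : {linear X -> F})
    (g : {linear F -> Z}) n :
  injective f -> exact_at f g -> (forall z, exists y, g y = z) ->
  flat_module F -> tor_vanishes n.+1 Z <-> tor_vanishes n X.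
Proof.
move=> f_inj fg g_surj flatF; split=> [exZ k0 k1 k2 A B AB|exX k0 k1 k2 A B].
  have exAB := syzygies_rows_exact AB.
  have [k3 [C exBC]] := rows_exact_extend noethS B.
  have CB0 : (B^T : 'M[S]_(k1, k2)) *m (C^T : 'M[S]_(k2, k3)) = 0.
    by rewrite -trmx_mulc (rows_exact_mul exBC) trmx0.
  apply: (exact_on_shift_left f_inj fg g_surj CB0); last exact: flat_exact_on.
  by apply: exZ; split=> //; exists k0, A.
move=> [exAB [k [A' A'A]]]; have exA'A := syzygies_rows_exact A'A.
have AA'0 : (A'^T : 'M[S]_(k, k0)) *m (A^T : 'M[S]_(k0, k1)) = 0.
  by rewrite -trmx_mulc (rows_exact_mul exA'A) trmx0.
apply: (exact_on_shift_right f_inj fg g_surj AA'0); first exact: exX.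
exact: flat_exact_on.
Qed.

Lemma flat_resolution_tor_vanishes n (Y : lmodType S) :
  has_flat_resolution Y n -> tor_vanishes n Y.
Proof.
elim: n Y => [|n IHn] Y [F [d [e [e_surj de dd flatF F0]]]].
  move=> k0 k1 k2 A B [exAB _]; apply/(exact_on_iso _ _ _ e_surj).
    apply: raddf_inj => x /de[y <-].
    by rewrite (F0 1%N isT y) linear0.
  exact: flat_exact_on.
have [K [i [i_inj iE]]] := submodule_exists (submodule_ker e).
have [|g gE] := linear_corestrict (f := d 0%N) i_inj.
  by move=> x; apply/iE/de; exists x.
apply/(tor_vanishes_shift (f := i) (g := e)) => //.
apply: IHn; exists (fun j => F j.+1), (fun j => d j.+1), g; split=> //.
- move=> k; have [x xE] : exists x, d 0%N x = i k by apply/de/iE; exists k.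
  by exists x; apply: i_inj; rewrite gE.
- move=> y; rewrite -dd -gE; split=> [->|]; first exact: linear0.
  by rewrite -(linear0 i) => /i_inj.
- by move=> j jn; exact: F0.
Qed.

Lemma zero_module_flat : flat_module ('rV[S]_0 : lmodType S).
Proof.
apply: (exact_on_flat noethS) => k0 k1 k2 A B _ v _.
by exists 0; apply/ffunP=> i; rewrite [LHS]thinmx0 [RHS]thinmx0.
Qed.

Lemma tor_vanishes_flat_resolution n (Y : lmodType S) :
  tor_vanishes n Y -> has_flat_resolution Y n.
Proof.
elim: n Y => [|n IHn] Y exY.
  have flatY : flat_module Y.
    by apply: (exact_on_flat noethS) => k0 k1 k2 A B exAB; exact: exY.
  pose F i : lmodType S := if i is 0%N then Y else 'rV[S]_0.
  exists F, (fun=> \0), idfun; split=> //.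
  - by move=> y; exists y.
  - by move=> y; split=> /= [->|[x <-] //]; exists 0.
  - move=> i y; split=> // _; exists 0.
    by rewrite [LHS](thinmx0 (_ : 'rV_0)) [RHS](thinmx0 (_ : 'rV_0)).
  - by case=> // i; exact: zero_module_flat.
  - by case=> // i _ x; exact: (thinmx0 (x : 'rV_0)).
have [F [p [flatF p_surj]]] := flat_cover Y.
have [K [i [i_inj iE]]] := submodule_exists (submodule_ker p).
have ip : exact_at i p by [].
have /IHn[G [d [e [e_surj de dd flatG G0]]]] : tor_vanishes n K.
  exact/(tor_vanishes_shift n i_inj ip p_surj flatF).
pose F' j : lmodType S := if j is l.+1 then G l else F.
pose d' j : {linear F' j.+1 -> F' j} :=
  match j with 0%N => i \o e | l.+1 => d l end.
exists F', d', p; split=> //.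
- move=> y; rewrite ip; split=> [[k <-]|[x <-]]; last by exists (e x).
  by have [x <-] := e_surj k; exists x.
- case=> [|j]; last exact: dd.
  move=> y; rewrite /= -de; split=> [|->]; last exact: linear0.
  by rewrite -(linear0 i) => /i_inj.
- by case.
- by case=> // j; exact: G0.
Qed.

Lemma flatdim_le n (Y : lmodType S) :
  (flatdim Y <= n%:Z%:E)%E <-> tor_vanishes n Y.
Proof.
rewrite least_nat_le; split=> [[m mn [F [d [e [e_surj de dd flatF F0]]]]]|exY].
  apply: flat_resolution_tor_vanishes; exists F, d, e; split=> // i ni.
  exact/F0/(leq_ltn_trans mn).
by exists n => //; exact: tor_vanishes_flat_resolution.
Qed.

End FlatResolutions.

(** * Left and right self-injective dimension *)

Section TwoSidedNoetherian.
Variable S : pzRingType.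
Hypotheses (noethS : left_noetherian S) (noethSc : left_noetherian S^c).

Lemma regular_flat : flat_module (S^o : lmodType S).
Proof.
apply: (exact_on_flat noethSc) => k0 k1 k2 A B exAB v Av0.
have /exAB[c cE] : (\row_i (v i : S^c)) *m A = 0.
  apply/matrixP=> i j; have /ffunP/(_ j) := Av0; rewrite !ffunE !mxE => vA.
  by rewrite -[RHS]vA; apply: eq_bigr => l _; rewrite !mxE.
exists [ffun j => c 0 j : S]; apply/ffunP=> i.
have /matrixP/(_ 0 i) := cE; rewrite !mxE !ffunE => ->.
by apply: eq_bigr => j _; rewrite !ffunE !mxE.
Qed.

(** Hom(-, S) turns left free modules into right ones and transposes the matrices. *)
Lemma regular_exact_rows k0 k1 k2 (A : 'M[S]_(k1, k0)) (B : 'M[S]_(k2, k1)) :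
  B *m A = 0 -> exact_on (S^o : lmodType S) A B ->
  rows_exact (B^T : 'M[S^c]_(k1, k2)) (A^T : 'M[S^c]_(k0, k1)).
Proof.
have rowE k l (C : 'M[S]_(k, l)) (w : 'rV[S^c]_l) i :
    (w *m (C^T : 'M[S^c]_(l, k))) 0 i = (act C [ffun j => w 0 j : S^o]) i.
  by rewrite mxE ffunE; apply: eq_bigr => j _; rewrite mxE ffunE.
move=> BA0 exAB w; split=> [wB|[c ->]].
  have [|u uE] := exAB [ffun j => w 0 j : S^o].
    by apply/ffunP=> i; rewrite -rowE wB mxE ffunE.
  exists (\row_j (u j : S^c)); apply/matrixP=> i j; rewrite !ord1 rowE.
  have -> : [ffun l => (\row_j (u j : S^c)) 0 l : S^o] = u.
    by apply/ffunP=> l; rewrite ffunE mxE.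
  by rewrite uE ffunE.
apply/matrixP=> i j; rewrite !ord1 rowE mxE.
rewrite (_ : [ffun _ => _] = act A [ffun j => c 0 j : S^o]).
  by rewrite -act_mul BA0 act0m ffunE.
by apply/ffunP=> l; rewrite ffunE rowE.
Qed.

(** Hom(S^k, M) is Hom(S^k, S) tensored with [M], so exactness of the dual sequence passes to every
    flat [M]; conversely, [S] itself is flat. *)
Lemma flat_injdim_le n :
  (forall M : lmodType S, flat_module M -> (injdim M <= n%:Z%:E)%E) <->
  ext_vanishes n (S^o : lmodType S).
Proof.
split=> [idS|exS M flatM].
  by apply/(injdim_le noethS)/idS; exact: regular_flat.
apply/(injdim_le noethS) => k0 k1 k2 A B AB.
have BA0 := rows_exact_mul (syzygies_rows_exact AB).
have /(flat_exact_on flatM) := regular_exact_rows BA0 (exS _ _ _ _ _ AB).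
by rewrite !trmxK.
Qed.

(* Over [S^c], the regular module is [S] acting on itself on the right. *)
Lemma regular_exact_cols k0 k1 k2 (A : 'M[S^c]_(k1, k0))
    (B : 'M[S^c]_(k2, k1)) :
  B *m A = 0 -> exact_on ((S^c)^o : lmodType S^c) A B <->
  rows_exact (B^T : 'M[S]_(k1, k2)) (A^T : 'M[S]_(k0, k1)).
Proof.
have rowE k l (C : 'M[S^c]_(k, l)) (w : 'rV[S]_l) i :
    (w *m (C^T : 'M[S]_(l, k))) 0 i = (act C [ffun j => w 0 j : (S^c)^o]) i.
  by rewrite mxE ffunE; apply: eq_bigr => j _; rewrite mxE ffunE.
have rowE' k l (C : 'M[S^c]_(k, l)) (v : {ffun 'I_l -> (S^c)^o}) i :
    ((\row_j (v j : S)) *m (C^T : 'M[S]_(l, k))) 0 i = act C v i.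
  rewrite rowE.
  have -> : [ffun l => (\row_j (v j : S)) 0 l : (S^c)^o] = v => //.
  by apply/ffunP=> j; rewrite ffunE mxE.
move=> BA0; split=> [exAB w|exAB v Bv0]; first split=> [wB|[c ->]].
- have [|u uE] := exAB [ffun j => w 0 j : (S^c)^o].
    by apply/ffunP=> i; rewrite -rowE wB mxE ffunE.
  exists (\row_j (u j : S)); apply/matrixP=> i j; rewrite !ord1 rowE' uE.
  by rewrite ffunE.
- by rewrite -mulmxA -trmx_mulc BA0 trmx0 mulmx0.
have /exAB[c cE] : (\row_j (v j : S)) *m (B^T : 'M[S]_(k1, k2)) = 0.
  by apply/matrixP=> i j; rewrite !ord1 rowE' Bv0 ffunE mxE.
exists [ffun j => c 0 j : (S^c)^o]; apply/ffunP=> i.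
by rewrite -rowE -cE mxE.
Qed.

(* [Tor_i(N, E) = Hom(Ext^i(N, S), E)] for [N] finitely generated and [E]     *)
(* injective; an injective module containing the cokernel of [A^T] detects    *)
(* the vanishing of [Ext].                                                    *)
Lemma injective_flatdim_le n :
  (forall M : lmodType S, injective_module M -> (flatdim M <= n%:Z%:E)%E) <->
  ext_vanishes n ((S^c)^o : lmodType S^c).
Proof.
split=> [fdS k0 k1 k2 A B AB|exS M injM]; last first.
  apply/(flatdim_le noethSc) => k0 k1 k2 A B AB.
  have BA0 := rows_exact_mul (syzygies_rows_exact AB).
  exact/(injective_exact_on injM)/(regular_exact_cols BA0)/exS.
have BA0 := rows_exact_mul (syzygies_rows_exact AB).
apply/(regular_exact_cols BA0) => w; split=> [wB|[c ->]]; last first.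
  by rewrite -mulmxA -trmx_mulc BA0 trmx0 mulmx0.
pose At : 'M[S]_(k0, k1) := A^T.
pose rowsA (x : 'rV[S]_k1) := exists c : 'rV[S]_k0, x = c *m At.
have sub_rowsA : submodule rowsA.
  split; first by exists 0; rewrite mul0mx.
    by move=> _ _ [c ->] [d ->]; exists (c + d); rewrite mulmxDl.
  by move=> a _ [c ->]; exists (a *: c); rewrite scalemxAl.
have [Q [p [_ p_ker]]] := quotient_exists sub_rowsA.
have [E [e [injE e_inj]]] := enough_injectives Q.
(* The images of the basis vectors satisfy the relations given by the rows of [At], so [y] comes
   from some [z] through the transpose of [B]. Then [w] annihilating that transpose gives
   [e (p w) = 0]. *)
pose y : {ffun 'I_k1 -> E} := [ffun i => e (p (delta_mx 0 i))].
have yE (x : 'rV[S]_k1) : e (p x) = \sum_i x 0 i *: y i.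
  rewrite [x in LHS]row_sum_delta !linear_sum; apply: eq_bigr => i _.
  by rewrite !linearZ ffunE.
have /(flatdim_le noethSc)/(_ _ _ _ _ _ AB) exE := fdS E injE.
have [|z zE] := exE y.
  apply/ffunP=> j; rewrite !ffunE; transitivity (e (p (row j At))).
    by rewrite yE; apply: eq_bigr => i _; rewrite !mxE.
  have -> : p (row j At) = 0.
    by apply/p_ker; exists (delta_mx 0 j); rewrite rowE.
  exact: linear0.
apply/p_ker/e_inj; rewrite linear0 yE -zE.
transitivity (\sum_j (w *m (B^T : 'M[S]_(k1, k2))) 0 j *: z j); last first.
  by rewrite big1 // => j _; rewrite wB mxE scale0r.
under eq_bigr => i _ do rewrite ffunE scaler_sumr.
rewrite exchange_big /=; apply: eq_bigr => j _; rewrite mxE scaler_suml.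
by apply: eq_bigr => i _; rewrite scalerA.
Qed.

End TwoSidedNoetherian.

(** * Transport along ring isomorphisms *)

Section RingIsomorphism.
Variables (S T : pzRingType) (f : {rmorphism S -> T}) (g : {rmorphism T -> S}).
Hypotheses (fK : cancel f g) (gK : cancel g f).

Lemma left_noetherian_iso : left_noetherian S -> left_noetherian T.
Proof.
move=> noethS I [I0 ID IM].
have [|s sE] := noethS (I \o f).
  split=> [|x y Ix Iy|a x Ix] /=; rewrite ?rmorph0 ?rmorphD ?rmorphM //.
    exact: ID.
  exact: IM.
exists (map f s) => x; rewrite size_map -[x in I x]gK.
split=> [/sE[c cE]|[c cE]].
  exists (f \o c); rewrite -[x]gK cE rmorph_sum; apply: eq_bigr => i _.
  by rewrite rmorphM (nth_map 0).
apply/sE; exists (g \o c); rewrite cE rmorph_sum; apply: eq_bigr => i _.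
by rewrite rmorphM (nth_map 0) // fK.
Qed.

Lemma rows_exact_map k0 k1 k2 (A : 'M[S]_(k1, k0)) (B : 'M[S]_(k2, k1)) :
  rows_exact A B -> rows_exact (map_mx f A) (map_mx f B).
Proof.
have map_fK m n (C : 'M[S]_(m, n)) : map_mx g (map_mx f C) = C.
  by apply/matrixP=> i j; rewrite !mxE fK.
have map_gK m n (C : 'M[T]_(m, n)) : map_mx f (map_mx g C) = C.
  by apply/matrixP=> i j; rewrite !mxE gK.
move=> exAB w; split=> [wA|[c ->]].
  have /exAB[c cE] : map_mx g w *m A = 0.
    by rewrite -[A]map_fK -map_mxM wA map_mx0.
  by exists (map_mx f c); rewrite -map_mxM -cE map_gK.
rewrite -mulmxA -map_mxM (rows_exact_mul exAB).
by rewrite map_mx0 mulmx0.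
Qed.

Lemma syzygies_map n k0 k1 k2 (A : 'M[S]_(k1, k0)) (B : 'M[S]_(k2, k1)) :
  syzygies n A B -> syzygies n (map_mx f A) (map_mx f B).
Proof.
elim: n k0 k1 k2 A B => [|n IHn] k0 k1 k2 A B [/rows_exact_map exAB] //.
by move=> [k [A' /IHn A'A]]; split=> //; exists k, (map_mx f A').
Qed.

Lemma ext_vanishes_regular_map n :
  ext_vanishes n (T^o : lmodType T) -> ext_vanishes n (S^o : lmodType S).
Proof.
move=> exT k0 k1 k2 A B /syzygies_map/exT exfAB v Bv0.
have actf k l (C : 'M[S]_(k, l)) (w : {ffun 'I_l -> S^o}) i :
    act (map_mx f C) [ffun j => f (w j) : T^o] i = f (act C w i).
  rewrite !ffunE rmorph_sum; apply: eq_bigr => j _.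
  by rewrite mxE ffunE; exact/esym/rmorphM.
have [|u uE] := exfAB [ffun j => f (v j) : T^o].
  by apply/ffunP=> i; rewrite actf Bv0 !ffunE rmorph0.
exists [ffun j => g (u j) : S^o]; apply/ffunP=> i; apply: (can_inj fK).
have /ffunP/(_ i) := uE; rewrite [RHS]ffunE => <-; rewrite -actf.
have -> // : [ffun j => f ([ffun l => g (u l) : S^o] j) : T^o] = u.
by apply/ffunP=> j; rewrite !ffunE gK.
Qed.

End RingIsomorphism.

(** For each [n] the two bounds are the vanishing of Ext^(n+1) into the regular module over [S^c]
    and over [S], and the isomorphism exchanges these. *)
Lemma sfli_silf (S : pzRingType) (f : {rmorphism S -> S^c})
    (g : {rmorphism S^c -> S}) :
  cancel f g -> cancel g f -> left_noetherian S -> sfli S = silf S.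
Proof.
move=> fK gK noethS; have noethSc := left_noetherian_iso fK gK noethS.
rewrite /sfli /silf; congr least_nat; apply/funext => n; apply/propext.
rewrite (flat_injdim_le noethS noethSc) (injective_flatdim_le noethSc).
by split; [exact: (ext_vanishes_regular_map fK gK)
  |exact: (ext_vanishes_regular_map gK fK)].
Qed.

(** * The anti-automorphism of the group ring induced by inversion *)

Section GroupRingInvolution.
Variables (R : comPzRingType) (G : groupType).

Local Notation RG := (group_ring R G).

Definition group_ring_inv (u : RG) : RG :=
  \sum_(x <- msupp u) mkmalgU (x^-1)%g (mcoeff x u).

Lemma group_ring_invE (d : {fset G}) (u : RG) : (msupp u `<=` d)%fset ->
  group_ring_inv u = \sum_(x <- d) mkmalgU (x^-1)%g (mcoeff x u).
Proof.
move=> ud; rewrite /group_ring_inv (big_fset_incl _ ud) //= => x _.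
by move=> /mcoeff_outdom ->; rewrite monalgU0.
Qed.

Lemma group_ring_invU x (a : R) :
  group_ring_inv (mkmalgU x a) = mkmalgU (x^-1)%g a.
Proof.
by rewrite (group_ring_invE (@msuppU_le _ _ _ _)) big_seq_fset1 mcoeffUU.
Qed.

Fact group_ring_inv_zmod_morphism : zmod_morphism group_ring_inv.
Proof.
move=> u v; rewrite (group_ring_invE (msuppB_le u v)).
rewrite (group_ring_invE (fsubsetUl _ (msupp v))).
rewrite (group_ring_invE (fsubsetUr (msupp u) _)) -sumrB.
by apply: eq_bigr => x _; rewrite mcoeffB monalgUB.
Qed.

HB.instance Definition _ :=
  GRing.isZmodMorphism.Build RG RG group_ring_inv group_ring_inv_zmod_morphism.

Lemma group_ring_invK : involutive group_ring_inv.
Proof.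
move=> u; rewrite [group_ring_inv u]/group_ring_inv raddf_sum [RHS]monalgE.
by apply: eq_bigr => x _; rewrite [LHS]group_ring_invU invgK.
Qed.

Lemma group_ring_inv1 : group_ring_inv 1 = 1.
Proof. by rewrite [LHS]group_ring_invU invg1. Qed.

(** Inversion reverses products in [G], and the coefficients can be swapped because [R] is
    commutative. *)
Lemma group_ring_invM u v :
  group_ring_inv (u * v) = group_ring_inv v * group_ring_inv u.
Proof.
rewrite -[RHS]/(grmul (\sum_(y <- msupp v) _) (\sum_(x <- msupp u) _)).
rewrite grmul_sumr [LHS]raddf_sum; apply: eq_bigr => x _.
rewrite grmul_suml [LHS]raddf_sum; apply: eq_bigr => y _.
by rewrite [LHS]group_ring_invU grmulUU invgM mulrC.
Qed.

End GroupRingInvolution.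

Theorem proposition5p6 (R : comPzRingType) (G : groupType)
  (gorR : gorenstein R) (noethRG : left_noetherian (group_ring R G)) :
  ((sfli (group_ring R G) < +oo)%E <-> (silf (group_ring R G) < +oo)%E) /\
  ((sfli (group_ring R G) < +oo)%E ->
   sfli (group_ring R G) = silf (group_ring R G)).
Proof.
pose RG : pzRingType := group_ring R G.
pose inv : RG -> RG := @group_ring_inv R G.
(* [RG] and [RG^c] share their underlying additive group, so the same involution is bundled in both
   directions and is its own inverse. *)
have invM : monoid_morphism (inv : RG -> RG^c).
  by split=> [|u v]; [exact: group_ring_inv1|exact: group_ring_invM].
have invM' : monoid_morphism (inv : RG^c -> RG).
  by split=> [|u v]; [exact: group_ring_inv1|exact: group_ring_invM].
have invA := @group_ring_inv_zmod_morphism R G.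
pose fA := GRing.isZmodMorphism.Build RG RG^c inv invA.
pose fM := GRing.isMonoidMorphism.Build RG RG^c inv invM.
pose f := HB.pack_for {rmorphism RG -> RG^c} inv fA fM.
pose gA := GRing.isZmodMorphism.Build RG^c RG inv invA.
pose gM := GRing.isMonoidMorphism.Build RG^c RG inv invM'.
pose g := HB.pack_for {rmorphism RG^c -> RG} inv gA gM.
have -> : sfli RG = silf RG; last by [].
by apply: (@sfli_silf RG f g) => //; exact: group_ring_invK.
Qed.
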